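(* Let $G=(\mathcal H,\mathcal V)$ be a two-dimensional graph on a finite vertex set, with adjacency matrices $H$ and $V$, and let $X_G$ be the two-dimensional shift space generated by $G$. Suppose that for all vertices $i,j$ one has $(HV)_{ij}\neq 0 \Leftrightarrow (VH)_{ij}\neq 0$. Let $r,s\in\mathbb Z$ with $rs>0$. Then $X_G$ is $(r,s)$-transitive if and only if one of the following holds: (i) $H^rV^s$ is irreducible; or (ii) $H^rV^s$ has exactly two irreducible permutation sub-matrices $A_1,A_2$, and these are such that for any $i\in A_1$ and $j\in A_2$ there exists a unique path connecting the two vertices (from $i$ to $j$), this path traversing all the vertices of $H^rV^s\setminus(A_1\cup A_2)$.
   Context: A two-dimensional graph $G=(\mathcal H,\mathcal V)$ is a pair of finite directed graphs (loops allowed, no multiple edges) on a common vertex set $A$, with $0$-$1$ adjacency matrices $H$ (for $\mathcal H$) and $V$ (for $\mathcal V$). It generates $X_G=\{x\in A^{\mathbb Z^2}: H_{x(m,n)\,x(m+1,n)}=1 \text{ and } V_{x(m,n)\,x(m,n+1)}=1 \text{ for all } (m,n)\in\mathbb Z^2\}$, with the subspace topology of the product topology on $A^{\mathbb Z^2}$ ($A$ discrete). Shift spaces (subshifts) are by definition non-empty, closed and shift-invariant. For $a\in\mathbb Z^2$, $(\sigma^a x)(k)=x(k+a)$. $X_G$ is $(r,s)$-transitive if for any non-empty open $U,W\subseteq X_G$ there is $k\in\mathbb Z$ with $\sigma^{(kr,ks)}(U)\cap W\neq\emptyset$. A non-negative square matrix $M$ is irreducible if for every pair of indices $i,j$ there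 is $k\in\mathbb N=\{1,2,\dots\}$ with $(M^k)_{ij}\neq 0$. The matrix $H^rV^s$ is regarded as the adjacency matrix of a directed (multi)graph on $A$; for $r,s<0$ it is read as $(H^T)^{|r|}(V^T)^{|s|}$. Sub-matrices are principal sub-matrices, identified with the sets of vertices indexing them; $H^rV^s\setminus(A_1\cup A_2)$ denotes the set of vertices indexing neither $A_1$ nor $A_2$. A path is a directed path without repeated vertices.
   Formalization: The formal theorem also assumes that every vertex occurs in some point of X_G, and in (ii) it requires A_1, A_2 to be the only irreducible sub-matrices (both being permutation matrices); without either change the claim is false. *)

(* Defs.v *)
(* MathComp / MathComp-Analysis. *)
From HB Require Import structures.
From mathcomp Require Import all_boot all_order all_algebra.
From mathcomp Require Import all_classical topology.

Set Implicit Arguments.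
Unset Strict Implicit.
Unset Printing Implicit Defensive.

Import Order.TTheory GRing.Theory Num.Theory.

Local Open Scope classical_set_scope.
Local Open Scope ring_scope.

(* Vertices are labelled by 'I_n.  A directed graph with loops but without
   multiple edges is a relation on the vertices. *)
Record graph2 (n : nat) := Graph2 { hgraph : rel 'I_n; vgraph : rel 'I_n }.

Definition adjmx n (e : rel 'I_n) : 'M[nat]_n := \matrix_(i, j) (e i j : nat).

Definition hmx n (G : graph2 n) : 'M[nat]_n := adjmx (hgraph G).
Definition vmx n (G : graph2 n) : 'M[nat]_n := adjmx (vgraph G).

(* A^(Z^2) with the product topology, A = 'I_n being discrete. *)
Definition configuration (n : nat) : Type :=
  {ptws int * int -> discrete_topology 'I_n}.
HB.instance Definition _ (n : nat) := Topological.copy (configuration n)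
  {ptws int * int -> discrete_topology 'I_n}.

Definition X_ n (G : graph2 n) : set (configuration n) :=
  [set x | forall p q : int,
     hmx G (x (p, q)) (x (p + 1, q)) = 1%N /\
     vmx G (x (p, q)) (x (p, q + 1)) = 1%N].

Definition shift n (a : int * int) (x : configuration n) : configuration n :=
  fun k => x (k + a).

(* U and W range over the non-empty relatively open subsets of X: a set of type
   [set (subspace X)] may also contain points outside X, hence the inclusions. *)
Definition transitive2 n (r s : int) (X : set (configuration n)) : Prop :=
  forall U W : set (subspace X),
    open U -> open W -> U `<=` X -> W `<=` X -> U !=set0 -> W !=set0 ->
    exists k : int, (shift (k * r, k * s) @` U) `&` W !=set0.

Definition irreducible_mx n (M : 'M[nat]_n) : Prop :=
  forall i j, exists2 k : nat, (0 < k)%N & (M ^+ k) i j != 0.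

(* M^r, read as (M^T)^|r| when r < 0. *)
Definition mxpowz n (M : 'M[nat]_n) (r : int) : 'M[nat]_n :=
  if 0 <= r then M ^+ `|r|%N else M^T ^+ `|r|%N.

Definition dirmx n (G : graph2 n) (r s : int) : 'M[nat]_n :=
  mxpowz (hmx G) r *m mxpowz (vmx G) s.

Definition principal_submx n (M : 'M[nat]_n) (S : {set 'I_n}) : 'M[nat]_#|S| :=
  mxsub enum_val enum_val M.

(* The empty (0 x 0) sub-matrix, vacuously irreducible, is excluded. *)
Definition irreducible_submx n (M : 'M[nat]_n) (S : {set 'I_n}) : Prop :=
  S != finset.set0 /\ irreducible_mx (principal_submx M S).

(* M is the adjacency matrix of a multigraph: the edges from u to v are the
   triples (u, v, e) with e < M u v.  A path leaving i is encoded by the list of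
   its steps (v, e), v being the vertex reached and e the label of the edge used,
   so that paths running through different parallel edges are different. *)
Definition mpath_vertices n (i : 'I_n) (p : seq ('I_n * nat)) : seq 'I_n :=
  i :: [seq w.1 | w <- p].

Definition is_mpath n (M : 'M[nat]_n) (i j : 'I_n) (p : seq ('I_n * nat)) :=
  [&& path (fun u w : 'I_n * nat => (w.2 < M u.1 w.1)%N) (i, 0%N) p,
      uniq (mpath_vertices i p) & last i [seq w.1 | w <- p] == j].

(* "Exactly two irreducible permutation sub-matrices": A1 and A2 are the only
   irreducible sub-matrices of M, and both are permutation matrices.  Other
   irreducible sub-matrices have to be excluded, permutation or not: in the
   vertex shift of [1 1 0; 1 0 1; 0 0 1] the states {0} and {2} are the only
   irreducible permutation sub-matrices and they are joined by the single path
   0 -> 1 -> 2, but {0, 1} is irreducible and the shift is not transitive. *)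
Definition two_cycles_joined n (M : 'M[nat]_n) : Prop :=
  exists A1 A2 : {set 'I_n},
    [/\ A1 <> A2,
        irreducible_submx M A1 /\ is_perm_mx (principal_submx M A1),
        irreducible_submx M A2 /\ is_perm_mx (principal_submx M A2),
        forall S : {set 'I_n}, irreducible_submx M S -> S = A1 \/ S = A2
      & forall i j, i \in A1 -> j \in A2 ->
          exists p, [/\ is_mpath M i j p,
                        forall q, is_mpath M i j q -> q = p
                      & forall v, v \notin (A1 :|: A2)%SET ->
                          v \in mpath_vertices i p]].

(* A is the alphabet of X_G, i.e. each vertex is a symbol of some point.
   Vertices that never occur do not affect X_G but make H^r V^s reducible. *)
Definition all_vertices_occur n (G : graph2 n) : Prop :=
  forall a : 'I_n, exists x k, X_ G x /\ x k = a.

(* Main.v *)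
Require Import Defs.
From mathcomp Require Import all_boot all_order all_algebra.
From mathcomp Require Import all_classical topology.
From mathcomp Require Import perm zify.

(** Write [M] for [H^r V^s].  By reflecting the plane one may assume that [r]
    and [s] are positive.

    Since [HV] and [VH] have the same zero pattern, a square of which two
    consecutive sides (right then up, or up then right) are given can be
    completed.  Completing squares one at a time fills a whole quadrant, so
    points of [X_G] can be glued: if [x] and [y] carry the same symbol at [c],
    some point equals [x] to the lower left of [c] and [y] to the upper right of
    [c] ([glue]).  Gluing makes every walk of [M] the diagonal [diag x], that is
    [k |-> x (k r, k s)], of a point [x], and [M u w] is at most 1 as soon as
    all points that carry [u] at the origin and [w] at [(r, s)] agree on the
    rectangle in between ([represents]).

    If [M] is irreducible, two windows of points are joined by a walk of [M]
    between their corners, hence [X_G] is transitive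
    ([irreducible_box_transitive]).

    Suppose that [X_G] is transitive and [M] is not irreducible.  The vertices
    reachable from a suitable vertex form a proper non-empty set [S] closed
    under successors.  A diagonal enters [S] at most once, so in a point that
    contains large windows of [x] and of [y], both entering [S] at time 0, the
    two windows must lie at the same place: there is a single point [x] entering
    [S] at time 0 ([crossing_unique]).  Its diagonal [w] therefore visits every
    vertex, uses every edge, and is determined backwards before it enters [S]
    and forwards afterwards.  Such an orbit is called [heteroclinic] here.  It
    runs round one cycle in the past and round another one in the future.  As
    every edge of [M] lies on a bi-infinite walk, condition (ii) of the theorem
    says exactly that [M] has a heteroclinic orbit ([heteroclinic_joined],
    [joined_heteroclinic]).

    Conversely let [w] be a heteroclinic orbit.  Every finite walk of [M] is a
    stretch of [w] ([het_factor]), so the diagonals of two points can be found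
    in one walk.  It remains to recover the points from their diagonals.  The
    entries of [M] add up to at most [n + 1]; being those of [H^r V^s], they add
    up to at least the sum of all entries of [H] and of [V] minus [n]
    ([entry_sum_mul]).  Hence [H] or [V] has only [n] edges and is the graph of
    a permutation, so that a point is determined by one symbol in each row, or in
    each column ([diag_determines]). *)

Set Implicit Arguments.
Unset Strict Implicit.
Unset Printing Implicit Defensive.

Import Order.TTheory GRing.Theory Num.Theory.

Local Open Scope classical_set_scope.
Local Open Scope ring_scope.

(** * The product topology in terms of boxes *)

Definition agree_on_box n (j : nat) (x y : int * int -> 'I_n) : Prop :=
  forall p q : int, - j%:Z <= p <= j%:Z -> - j%:Z <= q <= j%:Z ->
    x (p, q) = y (p, q).

(** Transitivity tested on square windows centred at the origin, which form a
    basis of neighbourhoods of every point. *)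
Definition box_transitive n (r s : int) (X : set (int * int -> 'I_n)) : Prop :=
  forall (j : nat) x y, X x -> X y -> exists (k : int) z,
    [/\ X z, agree_on_box j z x
      & agree_on_box j (fun a => z (a + (k * r, k * s))) y].

Lemma cvg_configuration n (F : set_system (configuration n))
    (x : configuration n) :
  Filter F -> (forall a, F [set z | z a = x a]) -> F --> x.
Proof.
move=> FF Fx; apply/cvg_sup => a B.
rewrite nbhsE => -[C [[D oD <-] Cx] CB].
by apply: filterS (Fx a) => z za; apply: CB; rewrite /= za.
Qed.

Lemma nbhs_configuration n (a : int * int) (x : configuration n) :
  nbhs x [set z | z a = x a].
Proof.
have := @proj_continuous _ (fun _ => discrete_topology 'I_n) a x.
move=> H; apply: (H [set y | y = x a]).
exact: (@discrete_set1 (discrete_topology 'I_n)).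
Qed.

Lemma nbhs_agree_on_box n (j : nat) (x : configuration n) :
  nbhs x [set z | agree_on_box j z x].
Proof.
have FF := nbhs_filter x.
pose f (i : 'I_(j.*2.+1) * 'I_(j.*2.+1)) : set (configuration n) :=
  [set z | z (i.1%:Z - j%:Z, i.2%:Z - j%:Z) = x (i.1%:Z - j%:Z, i.2%:Z - j%:Z)].
have : nbhs x [set z | forall i, f i z].
  by apply: (@filter_forall _ _ f _ FF) => i; apply: (@nbhs_configuration n (_, _)).
apply: filterS => z zf p q jp jq.
have p_lt : (absz (p + j%:Z)%R < j.*2.+1)%N by lia.
have q_lt : (absz (q + j%:Z)%R < j.*2.+1)%N by lia.
have := zf (Ordinal p_lt, Ordinal q_lt); rewrite /f /=.
have -> : (absz (p + j%:Z))%:Z - j%:Z = p by lia.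
by have -> : (absz (q + j%:Z))%:Z - j%:Z = q by lia.
Qed.

Lemma open_agree_on_box n (j : nat) (x : configuration n) :
  open ([set z | agree_on_box j z x] : set (configuration n)).
Proof.
rewrite openE => y yx; apply: filterS (nbhs_agree_on_box j y) => z zy p q jp jq.
by rewrite zy ?yx.
Qed.

(** Points outside [B] that agree with [x] on larger and larger boxes would
    converge to [x]. *)
Lemma nbhs_box n (x : configuration n) (B : set (configuration n)) :
  nbhs x B -> exists j, [set z | agree_on_box j z x] `<=` B.
Proof.
move=> xB; apply: contrapT => noj.
have /choice [u uP] : forall j : nat, exists z : configuration n,
    agree_on_box j z x /\ ~ B z.
  move=> j; apply: contrapT => noz; apply: noj; exists j => z zx.
  by apply: contrapT => nBz; apply: noz; exists z.
have ux : u @ \oo --> x.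
  apply: cvg_configuration => -[p q]; exists (`|p|%N + `|q|%N)%N => // j /= jl.
  by apply: (uP j).1; lia.
have [N _ NB] := ux _ xB.
by have [_] := uP N; apply; apply: (NB N); rewrite /=.
Qed.

Lemma transitive2_box n (r s : int) (X : set (configuration n)) :
  (forall a x, X x -> X (shift a x)) ->
  transitive2 r s X <-> box_transitive r s X.
Proof.
move=> Xshift; split=> [tr j x y Xx Xy | tr U W oU oW UX WX [x Ux] [y Wy]].
- pose C (t : configuration n) : set (subspace X) :=
    [set z : configuration n | agree_on_box j z t] `&` X.
  have oC t : open (C t).
    apply/open_subspaceP; exists [set z : configuration n | agree_on_box j z t].
      exact: open_agree_on_box.
    by rewrite /C -setIA setIid.
  have [k [z [[w [wx Xw] <-] [wy _]]]] : exists k : int,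
      (shift (k * r, k * s) @` C x) `&` C y !=set0.
    by apply: tr => //; [exact: subIsetr | exact: subIsetr |
      exists x; split | exists y; split].
  by exists k, w.
- have nbox (V : set (subspace X)) (t : configuration n) : open V -> V `<=` X ->
      V t -> exists j, forall z, X z -> agree_on_box j z t -> V z.
    move=> /open_subspaceP [V' oV' V'V] VX Vt.
    have Xt : X t by exact: VX.
    have [|j jV'] := @nbhs_box _ t V'.
      apply: open_nbhs_nbhs; split=> //.
      by have /seteqP [_ /(_ t)] := V'V; case.
    exists j => z Xz zt.
    by have /seteqP [/(_ z) + _] := V'V; case=> //; split=> //; apply: jV'.
  have [j1 j1U] := nbox U x oU UX Ux; have [j2 j2W] := nbox W y oW WX Wy.
  have [k [z [Xz zx zy]]] := tr (j1 + j2)%N x y (UX _ Ux) (WX _ Wy).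
  have Uz : U z by apply: j1U => // p q jp jq; apply: zx; lia.
  exists k, (shift (k * r, k * s) z); split; first by exists z.
  apply: j2W; first exact: Xshift.
  by move=> p q jp jq; apply: zy; lia.
Qed.

(** * Gluing points along a corner *)

(** The zero patterns of the products [HV] and [VH] coincide, that is, every
    square of which one corner path is given can be completed. *)
Definition commuting (A : Type) (h v : rel A) : Prop := forall a c : A,
  (exists b, h a b /\ v b c) <-> (exists d, v a d /\ h d c).

Definition admissible (A : Type) (h v : rel A) : set (int * int -> A) :=
  [set x | forall p q : int,
    h (x (p, q)) (x (p + 1, q)) /\ v (x (p, q)) (x (p, q + 1))].

Lemma rel_at (A : Type) (e : rel A) (x : int * int -> A) (p q p1 q1 s t s1 t1 : int) :
  e (x (p, q)) (x (s, t)) -> [/\ p = p1, q = q1, s = s1 & t = t1] ->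
  e (x (p1, q1)) (x (s1, t1)).
Proof. by move=> ? [<- <- <- <-]. Qed.
Arguments rel_at {A} e x {p q p1 q1 s t s1 t1}.

(** A quadrant is filled from its two sides, column by column and cell by cell;
    each new symbol completes the square whose other three symbols are known.
    The relations [R] and [T] may be [h] and [v] read backwards: the quadrants
    of the plane that can be filled in this way are the second and the fourth. *)
Lemma fill_quadrant (A : Type) (R T : rel A) (a b : nat -> A) :
  (forall w x y, R w x -> T w y -> exists d, T x d /\ R y d) ->
  a 0%N = b 0%N -> (forall i, R (a i) (a i.+1)) -> (forall j, T (b j) (b j.+1)) ->
  exists F : nat -> nat -> A,
    [/\ forall i, F i 0%N = a i, forall j, F 0%N j = b j,
        forall i j, R (F i j) (F i.+1 j) & forall i j, T (F i j) (F i j.+1)].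
Proof.
move=> comp ab Ra Tb.
have /choice [d dP] : forall t : A * A * A, exists d,
    R t.1.1 t.1.2 -> T t.1.1 t.2 -> T t.1.2 d /\ R t.2 d.
  move=> [[w x] y] /=; have [[Rwx Twy]|no] := pselect (R w x /\ T w y).
    by have [z ?] := comp _ _ _ Rwx Twy; exists z.
  by exists w => ? ?; case: no.
pose next (col : nat -> A) (x : A) :=
  fix nx (j : nat) : A := if j is k.+1 then d (col k, nx k, col k.+1) else x.
pose F := fix F (i : nat) : nat -> A :=
  if i is k.+1 then next (F k) (a k.+1) else b.
have nextP col x : (forall j, T (col j) (col j.+1)) -> R (col 0%N) x ->
    forall j, T (next col x j) (next col x j.+1) /\ R (col j) (next col x j).
  move=> Tc Rc j; have Rn : R (col j) (next col x j).
    by elim: j => [|j IH] //=; have [] := dP (col j, next col x j, col j.+1) IH (Tc j).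
  by split=> //; have [] := dP (col j, next col x j, col j.+1) Rn (Tc j).
have Fa i : F i 0%N = a i by case: i.
have FT i : forall j, T (F i j) (F i j.+1).
  elim: i => [|i IH] //= j.
  by have [] := nextP (F i) (a i.+1) IH _ j; rewrite ?Fa.
exists F; split=> // i j.
by have [] := nextP (F i) (a i.+1) (FT i) _ j; rewrite ?Fa.
Qed.

(** The data on the third and on the first quadrant provide the sides of the two
    other quadrants, and those are the quadrants that commutation allows to
    fill. *)
Lemma glue_quadrants (A : Type) (h v : rel A) (L U : nat -> nat -> A) :
  commuting h v -> L 0%N 0%N = U 0%N 0%N ->
  (forall i j, h (L i.+1 j) (L i j) /\ v (L i j.+1) (L i j)) ->
  (forall i j, h (U i j) (U i.+1 j) /\ v (U i j) (U i j.+1)) ->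
  exists z, [/\ admissible h v z,
    forall i j : nat, z (- i%:Z, - j%:Z) = L i j
  & forall i j : nat, z (i%:Z, j%:Z) = U i j].
Proof.
move=> hv LU LP UP.
have [F2 [F2a F2b F2h F2v]] : exists F : nat -> nat -> A,
    [/\ forall i, F i 0%N = L i 0%N, forall j, F 0%N j = U 0%N j,
        forall i j, h (F i.+1 j) (F i j) & forall i j, v (F i j) (F i j.+1)].
  apply: (@fill_quadrant A (fun a b => h b a) v) => // [a b c ba ac|i|j].
  - by have [d [bd dc]] := (hv b c).1 (ex_intro _ a (conj ba ac)); exists d.
  - by have [] := LP i 0%N.
  - by have [] := UP 0%N j.
have [F4 [F4a F4b F4h F4v]] : exists F : nat -> nat -> A,
    [/\ forall i, F i 0%N = U i 0%N, forall j, F 0%N j = L 0%N j,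
        forall i j, h (F i j) (F i.+1 j) & forall i j, v (F i j.+1) (F i j)].
  apply: (@fill_quadrant A h (fun a b => v b a)) => // [a b c ab ca|i|j].
  - by have [d [cd db]] := (hv c b).2 (ex_intro _ a (conj ca ab)); exists d.
  - by have [] := UP i 0%N.
  - by have [] := LP 0%N j.
pose z (a : int * int) : A := match a with
  | (Posz i, Posz j) => U i j
  | (Negz i, Posz j) => F2 i.+1 j
  | (Posz i, Negz j) => F4 i j.+1
  | (Negz i, Negz j) => L i.+1 j.+1
  end.
have zU (i j : nat) : z (i%:Z, j%:Z) = U i j by [].
have z2 (i j : nat) : z (- i%:Z, j%:Z) = F2 i j.
  by case: i => [|i] //; rewrite F2b.
have z4 (i j : nat) : z (i%:Z, - j%:Z) = F4 i j.
  by case: j => [|j] //; rewrite F4a.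
have zL (i j : nat) : z (- i%:Z, - j%:Z) = L i j.
  case: i j => [|i] [|j] //.
  - by rewrite -F4b.
  - by rewrite -F2a.
have predZ (i : nat) : - i.+1%:Z + 1 = - i%:Z :> int by lia.
have succZ (i : nat) : i%:Z + 1 = i.+1%:Z :> int by lia.
exists z; split=> // p q; split.
- case: p q => i [] j; rewrite ?NegzE ?predZ ?succZ ?(zU, z2, z4, zL) //.
  + by have [] := UP i j.
  + by have [] := LP i j.+1.
- case: p q => i [] j; rewrite ?NegzE ?predZ ?succZ ?(zU, z2, z4, zL) //.
  + by have [] := UP i j.
  + by have [] := LP i.+1 j.
Qed.

Lemma admissible_shift (A : Type) (h v : rel A) (c : int * int) x :
  admissible h v x -> admissible h v (fun a => x (a + c)).
Proof.
move=> xP p q; have [hx vx] := xP (p + c.1) (q + c.2).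
have addE s t : (s, t) + c = (s + c.1, t + c.2) by [].
split; rewrite /= !addE; [apply: (rel_at h x hx) | apply: (rel_at v x vx)];
  split; lia.
Qed.

Lemma glue (A : Type) (h v : rel A) (x y : int * int -> A) (c : int * int) :
  commuting h v -> admissible h v x -> admissible h v y -> x c = y c ->
  exists z, [/\ admissible h v z,
    forall p q, p <= c.1 -> q <= c.2 -> z (p, q) = x (p, q)
  & forall p q, c.1 <= p -> c.2 <= q -> z (p, q) = y (p, q)].
Proof.
move=> hv xP yP xyc.
pose L (i j : nat) := x (c.1 - i%:Z, c.2 - j%:Z).
pose U (i j : nat) := y (c.1 + i%:Z, c.2 + j%:Z).
have [|i j|i j|z [zP zL zU]] := @glue_quadrants A h v L U hv.
- have -> : L 0%N 0%N = x c by case: (c) @L => c1 c2 /=; congr (x (_, _)); lia.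
  by rewrite xyc; case: (c) @U => c1 c2 /=; congr (y (_, _)); lia.
- have [hx _] := xP (c.1 - i.+1%:Z) (c.2 - j%:Z).
  have [_ vx] := xP (c.1 - i%:Z) (c.2 - j.+1%:Z).
  split; [apply: (rel_at h x hx) | apply: (rel_at v x vx)]; split=> /=; lia.
- have [hy vy] := yP (c.1 + i%:Z) (c.2 + j%:Z).
  split; [apply: (rel_at h y hy) | apply: (rel_at v y vy)]; split=> /=; lia.
exists (fun a => z (a - c)); split=> [|p q pc qc|p q pc qc].
- exact: admissible_shift.
- have -> : (p, q) - c = (- (absz (c.1 - p))%:Z, - (absz (c.2 - q))%:Z).
    by congr (_, _) => /=; lia.
  by rewrite zL /L; congr (x (_, _)); lia.
- have -> : (p, q) - c = ((absz (p - c.1))%:Z, (absz (q - c.2))%:Z).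
    by congr (_, _) => /=; lia.
  by rewrite zU /U; congr (y (_, _)); lia.
Qed.

Lemma admissible_transpose (A : Type) (h v : rel A) x :
  admissible h v x -> admissible v h (fun a => x (a.2, a.1)).
Proof. by move=> xP p q; have [] := xP q p. Qed.

(** The first quadrant of [y] is moved one step to the right.  The column that
    this frees is the first column of a second quadrant filled from the edge
    and the negative half-axis of [x]. *)
Lemma realize_edge (A : Type) (h v : rel A) (x y : int * int -> A) :
  commuting h v -> admissible h v x -> admissible h v y -> h (x (0, 0)) (y (0, 0)) ->
  exists z, [/\ admissible h v z, z (0, 0) = x (0, 0) & z (1, 0) = y (0, 0)].
Proof.
move=> hv xP yP hxy.
pose a (i : nat) := if i is k.+1 then x (- k%:Z, 0) else y (0, 0).
have [||i|j|F [Fa Fb Fh Fv]] := @fill_quadrant A (fun s t => h t s) v a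
    (fun j => y (0, j%:Z)).
- move=> s t w ts sw.
  by have [d [? ?]] := (hv t w).1 (ex_intro _ s (conj ts sw)); exists d.
- by [].
- case: i => [|k]; first by rewrite /a oppr0.
  have [hx _] := xP (- k.+1%:Z) 0.
  by apply: (rel_at h x hx); split=> //=; lia.
- by have [_] := yP 0 j; have -> : j%:Z + 1 = j.+1%:Z by lia.
pose L (i j : nat) := x (- i%:Z, - j%:Z).
pose U (i j : nat) := if i is k.+1 then y (k%:Z, j%:Z) else F 1%N j.
have [|i j|i j|z [zP zL zU]] := @glue_quadrants A h v L U hv.
- by rewrite /U Fa.
- have [hx _] := xP (- i.+1%:Z) (- j%:Z); have [_ vx] := xP (- i%:Z) (- j.+1%:Z).
  split; [apply: (rel_at h x hx) | apply: (rel_at v x vx)]; split=> /=; lia.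
- case: i => [|k] /=; first by rewrite -Fb.
  have [hy vy] := yP k%:Z j%:Z.
  split; [apply: (rel_at h y hy) | apply: (rel_at v y vy)]; split=> /=; lia.
exists z; split=> //; first by rewrite -[(0, 0)]/(- 0%N%:Z, - 0%N%:Z) zL /L oppr0.
by rewrite -[(1, 0)]/(1%N%:Z, 0%N%:Z) zU.
Qed.

Lemma glue_at (A : Type) (h v : rel A) (x y : int * int -> A) (a b : int) :
  commuting h v -> admissible h v x -> admissible h v y ->
  x (a, b) = y (0, 0) ->
  exists z, [/\ admissible h v z,
    forall p q, p <= a -> q <= b -> z (p, q) = x (p, q)
  & forall p q, 0 <= p -> 0 <= q -> z (a + p, b + q) = y (p, q)].
Proof.
move=> hv xP yP xy.
have [||z [zP zx zy]] := @glue A h v x (fun t => y (t - (a, b))) (a, b) hv xP.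
- exact: admissible_shift.
- by have -> : (a, b) - (a, b) = (0, 0) by congr (_, _) => /=; lia.
exists z; split=> // p q p0 q0; rewrite zy /=; [|lia|lia].
by have -> : (a + p, b + q) - (a, b) = (p, q) by congr (_, _) => /=; lia.
Qed.

Lemma sum_mul_neq0 n (A B : 'M[nat]_n) u w :
  (A *m B) u w != 0%N -> exists2 t, A u t != 0%N & B t w != 0%N.
Proof.
rewrite mxE => /eqP ne; apply: contrapT => no; apply: ne.
apply: big1 => t _; have [->|At] := eqVneq (A u t) 0%N; first by rewrite mul0r.
have [->|Bt] := eqVneq (B t w) 0%N; first by rewrite mulr0.
by case: no; exists t.
Qed.

Lemma mul_neq0 n (A B : 'M[nat]_n) u t w :
  A u t != 0%N -> B t w != 0%N -> (A *m B) u w != 0%N.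
Proof.
move=> At Bt; rewrite mxE (bigD1 t) //=.
have : (A u t * B t w != 0)%N by rewrite muln_eq0 negb_or At.
rewrite /GRing.mul /= /GRing.add /=; lia.
Qed.

(** * Matrices that count patterns *)

Section Realization.
Variables (n : nat) (h v : rel 'I_n).
Hypothesis hv : commuting h v.
Hypothesis occurs : forall a, exists2 x, admissible h v x & x (0, 0) = a.

(** [A] describes the pairs of symbols at displacement [(a, b)].  The third
    clause is the only trace of multiplicities: an entry counts ways of filling
    in the points between the two symbols, so it is at most 1 when the points
    of [X_G] show a single filling.  In this form the three clauses are stable
    under products. *)
Record represents (A : 'M[nat]_n) (a b : nat) : Prop := Represents {
  represents_sound : forall x, admissible h v x -> A (x (0, 0)) (x (a%:Z, b%:Z)) != 0%N;
  represents_real : forall u w, A u w != 0%N ->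
    exists x, [/\ admissible h v x, x (0, 0) = u & x (a%:Z, b%:Z) = w];
  represents_tight : forall u w,
    (forall x y, admissible h v x -> admissible h v y -> x (0, 0) = u -> y (0, 0) = u ->
      x (a%:Z, b%:Z) = w -> y (a%:Z, b%:Z) = w ->
      forall p q : int, 0 <= p <= a%:Z -> 0 <= q <= b%:Z -> x (p, q) = y (p, q)) ->
    (A u w <= 1)%N }.

Lemma represents_sound_at A a b x (p q : int) :
  represents A a b -> admissible h v x ->
  A (x (p, q)) (x (p + a%:Z, q + b%:Z)) != 0%N.
Proof.
move=> AP xP; have := represents_sound AP (admissible_shift (p, q) xP).
have -> : (0, 0) + (p, q) = (p, q) by congr (_, _) => /=; lia.
by have -> : (a%:Z, b%:Z) + (p, q) = (p + a%:Z, q + b%:Z) by congr (_, _) => /=; lia.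
Qed.

Lemma represents1 : represents 1%:M 0 0.
Proof.
split=> [x _|u w|u w _]; rewrite !mxE ?eqxx //; last by case: eqP.
have [<- _|] := eqVneq u w; last by rewrite eqxx.
by have [x xP xu] := occurs u; exists x; split.
Qed.

(** A point showing [A *m B] is obtained by gluing a point showing [A] and one
    showing [B] at the intermediate symbol.  Gluing also gives the third clause:
    if the glued points agree, then so do the intermediate symbols and the
    points on each of the two smaller rectangles. *)
Lemma represents_mul A a b B c d :
  represents A a b -> represents B c d ->
  represents (A *m B) (a + c)%N (b + d)%N.
Proof.
move=> AP BP.
have EZ (x : int * int -> 'I_n) : x ((a + c)%N%:Z, (b + d)%N%:Z) = x (a%:Z + c%:Z, b%:Z + d%:Z).
  by congr (x (_, _)); lia.
split=> [x xP|u w /sum_mul_neq0 [t At Bt]|u w agree].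
- rewrite EZ; apply: mul_neq0 (represents_sound AP xP) _.
  exact: (represents_sound_at a%:Z b%:Z BP xP).
- have [x [xP xu xt]] := represents_real AP At.
  have [y [yP yt yw]] := represents_real BP Bt.
  have [|z [zP zx zy]] := @glue_at _ h v x y a b hv xP yP; first by rewrite xt.
  by exists z; split=> //; [rewrite zx | rewrite EZ zy].
have [|neq0] := eqVneq ((A *m B) u w) 0%N; first by move=> ->.
have [t At Bt] := sum_mul_neq0 neq0.
have glued x y : admissible h v x -> admissible h v y -> x (0, 0) = u ->
    x (a%:Z, b%:Z) = y (0, 0) -> y (c%:Z, d%:Z) = w ->
    exists z, [/\ admissible h v z, z (0, 0) = u, z ((a + c)%N%:Z, (b + d)%N%:Z) = w,
    forall p q : int, p <= a%:Z -> q <= b%:Z -> z (p, q) = x (p, q)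
  & forall p q : int, 0 <= p -> 0 <= q -> z (a%:Z + p, b%:Z + q) = y (p, q)].
  move=> xP yP xu xy yw; have [z [zP zx zy]] := glue_at hv xP yP xy.
  by exists z; split=> //; [rewrite zx | rewrite EZ zy].
have [x [xP xu xt]] := represents_real AP At.
have [y [yP yt yw]] := represents_real BP Bt.
have [|z [zP zu zw zx zy]] := glued x y xP yP xu _ yw; first by rewrite xt.
rewrite mxE (bigD1 t) //= big1 => [|t' t't].
  rewrite addr0; have A1 : (A u t <= 1)%N.
    apply: (represents_tight AP) => x1 x2 x1P x2P x1u x2u x1t x2t p q pa qb.
    have [|z1 [z1P z1u z1w z1x _]] := glued x1 y x1P yP x1u _ yw; first by rewrite x1t.
    have [|z2 [z2P z2u z2w z2x _]] := glued x2 y x2P yP x2u _ yw; first by rewrite x2t.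
    rewrite -z1x -?z2x; try lia.
    by apply: agree => //; lia.
  have B1 : (B t w <= 1)%N.
    apply: (represents_tight BP) => y1 y2 y1P y2P y1t y2t y1w y2w p q pa qb.
    have [|z1 [z1P z1u z1w _ z1y]] := glued x y1 xP y1P xu _ y1w; first by rewrite xt.
    have [|z2 [z2P z2u z2w _ z2y]] := glued x y2 xP y2P xu _ y2w; first by rewrite xt.
    rewrite -z1y -?z2y; try lia.
    by apply: agree => //; lia.
  by rewrite /GRing.mul /=; nia.
have [->|At'] := eqVneq (A u t') 0%N; first by rewrite mul0r.
have [->|Bt'] := eqVneq (B t' w) 0%N; first by rewrite mulr0.
have [x' [x'P x'u x't]] := represents_real AP At'.
have [y' [y'P y't y'w]] := represents_real BP Bt'.
have [|z' [z'P z'u z'w z'x _]] := glued x' y' x'P y'P x'u _ y'w; first by rewrite x't.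
case/eqP: t't; rewrite -x't -xt -zx // -z'x //.
by apply: agree => //; lia.
Qed.

Lemma represents_exp A a b k :
  represents A a b -> represents (A ^+ k) (k * a)%N (k * b)%N.
Proof.
move=> AP; elim: k => [|k IH]; first by rewrite expr0 !mul0n; exact: represents1.
by rewrite exprS !mulSn; apply: represents_mul.
Qed.

Lemma represents_h : represents (adjmx h) 1 0.
Proof.
split=> [x xP|u w|u w _]; rewrite mxE; last by case: h.
  by have [] := xP 0 0; rewrite add0r => ->.
case huw : (h u w) => // _.
have [x xP xu] := occurs u; have [y yP yw] := occurs w.
have [|z [zP zx zy]] := realize_edge hv xP yP; first by rewrite xu yw.
by exists z; split=> //; rewrite ?zx ?zy.
Qed.
End Realization.

Lemma commuting_sym (A : Type) (h v : rel A) : commuting h v -> commuting v h.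
Proof. by move=> hv a c; split=> /hv. Qed.

Lemma represents_v n (h v : rel 'I_n) : commuting h v ->
  (forall a, exists2 x, admissible h v x & x (0, 0) = a) ->
  represents h v (adjmx v) 0 1.
Proof.
move=> hv occurs.
have [|s r _] := represents_h (commuting_sym hv) _.
  move=> a; have [x xP xa] := occurs a.
  by exists (fun t => x (t.2, t.1)) => //; exact: admissible_transpose.
split=> [x xP|u w uw|u w _]; last by rewrite mxE; case: (v _ _).
  exact: (s _ (admissible_transpose xP)).
have [x [xP xu xw]] := r _ _ uw.
by exists (fun t => x (t.2, t.1)); split=> //; exact: admissible_transpose.
Qed.

(** * Diagonals *)

(** The multigraph of [M] is traversed completely by one bi-infinite walk, all
    edges being simple.  The walk never comes back to a vertex of its past
    [t <= 0] at a time [t > 0]; the past is determined backwards and the future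
    forwards, so both are eventually periodic because there are finitely many
    vertices. *)
Definition heteroclinic n (M : 'M[nat]_n) (w : int -> 'I_n) : Prop :=
  [/\ forall u, exists t, w t = u,
      forall t t' : int, t <= 0 -> 0 < t' -> w t <> w t',
      forall t, M (w t) (w (t + 1)) = 1%N,
      forall u u', M u u' != 0%N -> exists t, u = w t /\ u' = w (t + 1)
    & (forall t t' : int, 0 < t -> 0 < t' -> w t = w t' -> w (t + 1) = w (t' + 1)) /\
      (forall t t' : int, t <= 0 -> t' <= 0 -> w t = w t' -> w (t - 1) = w (t' - 1))].

Section Diagonal.
Variables (n : nat) (h v : rel 'I_n).
Hypothesis hv : commuting h v.
Hypothesis occurs : forall a, exists2 x, admissible h v x & x (0, 0) = a.
Variables (M : 'M[nat]_n) (r s : nat).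
Hypothesis MP : represents h v M r s.
Local Notation X := (admissible h v).

(** For [x] in [X_G] this is a walk of [H^r V^s], and a shift of [x] by a multiple
    of [(r, s)] shifts the walk. *)
Definition diag (x : int * int -> 'I_n) (k : int) : 'I_n := x (k * r%:Z, k * s%:Z).

Lemma diag0 x : diag x 0 = x (0, 0).
Proof. by rewrite /diag !mul0r. Qed.

Lemma diag_nat x (k : nat) : diag x k%:Z = x ((k * r)%N%:Z, (k * s)%N%:Z).
Proof. by congr (x (_, _)); lia. Qed.

Lemma diag_shift x (k m : int) :
  diag (fun t => x (t + (k * r%:Z, k * s%:Z))) m = diag x (k + m).
Proof.
rewrite /diag /=.
by congr x; congr (_, _) => /=; lia.
Qed.

Lemma diag_pow x (i : int) (k : nat) :
  X x -> (M ^+ k) (diag x i) (diag x (i + k%:Z)) != 0%N.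
Proof.
have -> : diag x (i + k%:Z) = x (i * r%:Z + (k * r)%N%:Z, i * s%:Z + (k * s)%N%:Z).
  by congr (x (_, _)); lia.
exact: represents_sound_at (represents_exp hv occurs k MP).
Qed.

Lemma diag_edge x (i : int) : X x -> M (diag x i) (diag x (i + 1)) != 0%N.
Proof. by move=> xP; have := diag_pow i 1 xP; rewrite expr1. Qed.

Lemma realize_pow (k : nat) u w : (M ^+ k) u w != 0%N ->
  exists x, [/\ X x, diag x 0 = u & diag x k%:Z = w].
Proof.
move=> /(represents_real (represents_exp hv occurs k MP)) [x [xP xu xw]].
by exists x; rewrite diag0 diag_nat.
Qed.

Lemma realize_edge_diag u w : M u w != 0%N ->
  exists x, [/\ X x, diag x 0 = u & diag x 1 = w].
Proof. by move=> uw; apply: (@realize_pow 1); rewrite expr1. Qed.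

Lemma glue_diag x y (i i' : int) : X x -> X y -> diag x i = diag y i' ->
  exists z, [/\ X z,
    forall p q, p <= i * r%:Z -> q <= i * s%:Z -> z (p, q) = x (p, q)
  & forall p q : int, i * r%:Z <= p -> i * s%:Z <= q ->
      z (p, q) = y (p + (i' - i) * r%:Z, q + (i' - i) * s%:Z)].
Proof.
move=> xP yP xy.
have [|z [zP zx zy]] := @glue_at _ h v x (fun t => y (t + (i' * r%:Z, i' * s%:Z)))
    (i * r%:Z) (i * s%:Z) hv xP (admissible_shift _ yP).
  by rewrite -/(diag x i) xy /diag; congr y; congr (_, _) => /=; lia.
exists z; split=> // p q pi qi.
have -> : (p, q) = (i * r%:Z + (p - i * r%:Z), i * s%:Z + (q - i * s%:Z)).
  by congr (_, _); lia.
rewrite zy; [|lia|lia].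
by congr y; congr (_, _) => /=; lia.
Qed.

Hypotheses (r_gt0 : (0 < r)%N) (s_gt0 : (0 < s)%N).

Lemma splice x y (i i' : int) : X x -> X y -> diag x i = diag y i' ->
  exists z, [/\ X z, forall m, m <= i -> diag z m = diag x m
    & forall m, i <= m -> diag z m = diag y (m - i + i')].
Proof.
move=> xP yP /(glue_diag xP yP) [z [zP zx zy]]; exists z; split=> // m mi.
  by rewrite /diag zx //; nia.
by rewrite /diag zy; [congr (y (_, _)); lia | nia | nia].
Qed.

(** The upper right corner of the window of [x] is joined by a walk to the lower
    left corner of the window of [y]; gluing at both corners keeps the windows. *)
Lemma irreducible_box_transitive : irreducible_mx M -> box_transitive r%:Z s%:Z X.
Proof.
move=> irr j x y xP yP.
have [k k_gt0 /realize_pow [z [zP zx zy]]] := irr (diag x j%:Z) (diag y (- j%:Z)).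
have [t [tP tx tz]] := glue_diag xP zP (esym zx).
have [|c [cP ct cy]] := @glue_diag t y (j + k)%N%:Z (- j%:Z) tP yP.
  rewrite -zy /diag tz; [congr (z (_, _)); lia | nia | nia].
exists (j.*2 + k)%N%:Z, c; split=> // p q pj qj.
- by rewrite ct ?tx //; nia.
- have -> : (p, q) + ((j.*2 + k)%N%:Z * r%:Z, (j.*2 + k)%N%:Z * s%:Z) =
    (p + (j.*2 + k)%N%:Z * r%:Z, q + (j.*2 + k)%N%:Z * s%:Z) by [].
  by rewrite cy; [congr (y (_, _)); lia | nia | nia].
Qed.

Lemma diag_closed (S : 'I_n -> Prop) x (i j : int) :
  (forall u w, S u -> M u w != 0%N -> S w) -> X x -> i <= j ->
  S (diag x i) -> S (diag x j).
Proof.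
move=> Sc xP ij Si; have -> : j = i + (absz (j - i))%:Z by lia.
elim: (absz (j - i)) => [|k IH]; first by rewrite addr0.
have -> : i + k.+1%:Z = i + k%:Z + 1 by lia.
exact: Sc IH (diag_edge _ xP).
Qed.

Hypothesis tr : box_transitive r%:Z s%:Z X.

(** A diagonal enters the closed set [S] at most once.  A point containing windows
    of [x] and of [y] therefore contains them at the same place, so the windows
    coincide. *)
Lemma crossing_unique (S : 'I_n -> Prop) x y :
  (forall u w, S u -> M u w != 0%N -> S w) -> X x -> X y ->
  ~ S (diag x 0) -> S (diag x 1) -> ~ S (diag y 0) -> S (diag y 1) ->
  forall p q, x (p, q) = y (p, q).
Proof.
move=> Sc xP yP x0 x1 y0 y1 p q.
have [k [z [zP zx zy]]] := @tr (absz p + absz q + r + s)%N x y xP yP.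
have zxd m : 0 <= m <= 1 -> diag z m = diag x m by move=> m01; apply: zx; nia.
have zyd m : 0 <= m <= 1 -> diag z (k + m) = diag y m.
  by move=> m01; rewrite -diag_shift; apply: zy; nia.
have k_le0 : k <= 0.
  rewrite leNgt; apply/negP => k_gt0; apply: y0; rewrite -zyd // addr0.
  by apply: (@diag_closed S z 1) => //; rewrite zxd.
have k_ge0 : 0 <= k.
  rewrite leNgt; apply/negP => k_lt0; apply: x0; rewrite -zxd //.
  by apply: (@diag_closed S z (k + 1)) => //; [lia | rewrite zyd].
have k0 : k = 0 by lia.
rewrite -zx; [|lia|lia]; rewrite -zy; [|lia|lia].
by rewrite k0 !mul0r; congr z; congr (_, _) => /=; lia.
Qed.

Lemma transitive_comparable a b : [\/ a = b,
  exists2 k : nat, (0 < k)%N & (M ^+ k) a b != 0%N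
| exists2 k : nat, (0 < k)%N & (M ^+ k) b a != 0%N].
Proof.
have [x xP xa] := occurs a; have [y yP yb] := occurs b.
have [k [z [zP zx zy]]] := @tr 0%N x y xP yP.
have za : diag z 0 = a by rewrite diag0 -xa; apply: zx.
have zb : diag z k = b.
  by rewrite -[k]addr0 -diag_shift diag0 -yb; apply: zy.
case: (ltrgtP k 0) => [k0|k0|k0].
- apply: Or33; exists (absz k); first lia.
  rewrite -za -zb; have := diag_pow k (absz k) zP.
  by have -> : k + (absz k)%:Z = 0 by lia.
- apply: Or32; exists (absz k); first lia.
  rewrite -za -zb; have := diag_pow 0 (absz k) zP.
  by have -> : 0 + (absz k)%:Z = k by lia.
- by apply: Or31; rewrite -za -zb k0.
Qed.

Lemma crossing_time (S : 'I_n -> Prop) x (k : nat) :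
  X x -> ~ S (diag x 0) -> S (diag x k%:Z) ->
  exists t : nat, [/\ (t < k)%N, ~ S (diag x t%:Z) & S (diag x (t%:Z + 1))].
Proof.
move=> xP x0; elim: k => [//|k IH] xk.
have [/IH [t [tk nt St]]|nk] := pselect (S (diag x k%:Z)).
  by exists t; split=> //; exact: ltnW.
by exists k; split=> //; have -> : k%:Z + 1 = k.+1%:Z by lia.
Qed.

(** The orbit is the diagonal of the unique point [x] that enters the closed set
    [S] at time 0, where [S] consists of the vertices reached from a vertex [i]
    that does not reach everything.  Every property of the orbit is obtained in
    the same way: splice a piece of another point into [x] so that the entrance
    into [S] is kept; the result is [x] again. *)
Lemma transitive_heteroclinic :
  ~ irreducible_mx M -> exists w, heteroclinic M w.
Proof.
move=> nirr.
have [i [j nij]] : exists i j, ~ exists2 k : nat, (0 < k)%N & (M ^+ k) i j != 0%N.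
  apply: contrapT => no; apply: nirr => i j; apply: contrapT => nij.
  by apply: no; exists i, j.
pose S u := exists2 k : nat, (0 < k)%N & (M ^+ k) i u != 0%N.
have Sc u w : S u -> M u w != 0%N -> S w.
  move=> [k k0 iu] uw; exists k.+1 => //; rewrite exprSr.
  exact: mul_neq0 iu uw.
have [v1 Sv1] : exists v1, S v1.
  have [x xP xi] := occurs i; exists (diag x 1), 1%N => //.
  by rewrite expr1 -xi -diag0; have := diag_edge 0 xP; rewrite add0r.
have Spow u w k : (M ^+ k) u w != 0%N -> S u -> S w.
  move=> /realize_pow [x [xP <- <-]]; exact: diag_closed.
have cross u w k : ~ S u -> S w -> (M ^+ k) u w != 0%N ->
    exists x (t : nat), [/\ X x, diag x 0 = u, diag x k%:Z = w, (t < k)%N &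
      ~ S (diag x t%:Z) /\ S (diag x (t%:Z + 1))].
  move=> Su Sw /realize_pow [x [xP xu xw]].
  have [||t [tk nt St]] := @crossing_time S x k xP; rewrite ?xu ?xw //.
  by exists x, t; split.
have jv1 : exists2 k, (0 < k)%N & (M ^+ k) j v1 != 0%N.
  have [jv|//|[k k0 v1j]] := transitive_comparable j v1.
    by case: nij; rewrite jv.
  by case: nij; exact: Spow v1j Sv1.
have [x [xP x0 x1]] : exists x, [/\ X x, ~ S (diag x 0) & S (diag x 1)].
  have [k k0 /cross] := jv1 => /(_ nij Sv1) [x [t [xP _ _ _ [nt St]]]].
  exists (fun a => x (a + (t%:Z * r%:Z, t%:Z * s%:Z))).
  by rewrite !diag_shift addr0; split=> //; exact: admissible_shift.
have uniq y c : X y -> ~ S (diag y c) -> S (diag y (c + 1)) ->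
    forall m, diag y (c + m) = diag x m.
  move=> yP yc yc1 m; rewrite -diag_shift.
  apply: (@crossing_unique S _ x Sc (admissible_shift _ yP) xP) => //;
    by rewrite diag_shift ?addr0.
pose w := diag x; exists w.
have wS t : 0 < t -> S (w t) by move=> t0; apply: diag_closed x1.
have wnS t : t <= 0 -> ~ S (w t) by move=> t0 St; apply: x0; apply: diag_closed St.
have from u z k : ~ S u -> S z -> (M ^+ k) u z != 0%N ->
    exists t : nat, u = w (- t%:Z) /\ z = w (k%:Z - t%:Z).
  move=> Su Sz /(cross _ _ _ Su Sz) [y [t [yP <- <- _ [nt St]]]].
  exists t; rewrite /w -!(uniq _ _ yP nt St).
  by split; congr (diag y _); lia.
have surj u : exists t, w t = u.
  have [Su|Su] := pselect (S u).
    have [ju|[k k0 ju]|[k k0 uj]] := transitive_comparable j u.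
    - by case: nij; rewrite ju.
    - by have [t [_ ->]] := from _ _ _ nij Su ju; exists (k%:Z - t%:Z).
    - by case: nij; exact: Spow uj Su.
  have [uv|[k k0 uv]|[k k0 vu]] := transitive_comparable u v1.
  - by case: Su; rewrite uv.
  - by have [t [-> _]] := from _ _ _ Su Sv1 uv; exists (- t%:Z).
  - by case: Su; exact: Spow vu Sv1.
(* A point that meets the future of [w] can replace the rest of [x]. *)
have fwd t y c : 0 < t -> X y -> w t = diag y c ->
    forall m, 0 <= m -> diag y (c + m) = w (t + m).
  move=> t0 yP tc m m0; have [z [zP zx zy]] := splice xP yP tc.
  have := uniq z 0 zP; rewrite zx; last by lia.
  rewrite zx; last by lia.
  move=> /(_ x0 x1 (t + m)); rewrite /w => <-; rewrite zy; last by lia.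
  by congr (diag y _); lia.
(* A point that meets the past of [w] can replace all that precedes. *)
have bwd t y c : t <= 0 -> X y -> w t = diag y c ->
    forall m, 0 <= m -> diag y (c - m) = w (t - m).
  move=> t0 yP tc m m0; have [z [zP zy zx]] := splice yP xP (esym tc).
  have := uniq z (c - t) zP; rewrite zx; last by lia.
  rewrite zx; last by lia.
  have -> : c - t - c + t = 0 by lia.
  have -> : c - t + 1 - c + t = 1 by lia.
  move=> /(_ x0 x1 (t - m)); rewrite /w => <-; rewrite -[in LHS]zy; last by lia.
  by congr (diag z _); lia.
split=> //.
- by move=> t t' t0 t'0 tt'; apply: (wnS t t0); rewrite tt'; exact: wS.
- move=> t; apply/eqP; rewrite eqn_leq lt0n diag_edge // andbT.
  apply: (represents_tight MP).
  suff agree y : X y -> diag y 0 = w t -> diag y 1 = w (t + 1) ->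
      forall p q : int, 0 <= p <= r%:Z -> 0 <= q <= s%:Z ->
      y (p, q) = x (t * r%:Z + p, t * s%:Z + q).
    move=> y y' yP y'P y0 y'0 y1 y'1 p q pr qs.
    by rewrite (agree y) ?(agree y') // ?diag0 // -?(diag_nat y 1) -?(diag_nat y' 1) /diag !mul1r.
  move=> yP y0 y1 p q pr qs.
  (* [c] equals [x] up to time [t], then [y] until time [t + 1], then [x]. *)
  have [z [zP zx zy]] := glue_diag xP yP (esym y0).
  have z1 : diag z (t + 1) = w (t + 1).
    by rewrite -y1 /diag zy; [congr (y (_, _)); lia | nia | nia].
  have [c [cP cz cx]] := glue_diag zP xP z1.
  have c_ge m : t + 1 <= m -> diag c m = w m.
    by move=> tm; rewrite /diag cx; [congr (x (_, _)); lia | nia | nia].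
  have c_le m : m <= t -> diag c m = w m.
    by move=> tm; rewrite /diag cz ?zx //; nia.
  have c_w m : diag c m = w m.
    by have [/c_le|tm] := leP m t; last by apply: c_ge; lia.
  rewrite -(@crossing_unique S c x) //; rewrite ?c_w //.
  by rewrite cz ?zy; try lia; congr (y (_, _)); lia.
- move=> u u' uu'; have [y [yP yu yu']] := realize_edge_diag uu'.
  have [Su|Su] := pselect (S u).
    have [t tu] := surj u.
    have t0 : 0 < t.
      by rewrite ltNge; apply/negP => t0; apply: (wnS t t0); rewrite tu.
    exists t; split=> //; rewrite -yu' -[1]add0r; symmetry.
    by rewrite -(fwd _ y 0) // yu.
  have [Su'|Su'] := pselect (S u').
    exists 0; have := uniq y 0 yP; rewrite yu yu' => /(_ Su Su') yw.
    by rewrite -yu -yu' -[X in diag y X]add0r /w -!yw.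
  have [t tu'] := surj u'.
  have t0 : t <= 0.
    by rewrite leNgt; apply/negP => t0; apply: Su'; rewrite -tu'; exact: wS.
  exists (t - 1); rewrite subrK; split=> //.
  by rewrite -(bwd _ y 1) ?subrr ?yu // yu'.
- split=> t t' t0 t'0 tt'; symmetry.
  + exact: fwd.
  + exact: bwd.
Qed.
End Diagonal.

(** * Walks and entries of a matrix with a heteroclinic orbit *)

Section Heteroclinic.
Variables (n : nat) (M : 'M[nat]_n) (w : int -> 'I_n).
Hypothesis het : heteroclinic M w.

Lemma het_pos (t t' : int) : w t = w t' -> 0 < t -> 0 < t'.
Proof.
have [_ sep _ _ _] := het; move=> tt' t0; rewrite ltNge; apply/negP => t'0.
exact: (sep _ _ t'0 t0).
Qed.

Lemma het_fwd (t t' : int) (k : nat) : w t = w t' -> 0 < t -> w (t + k%:Z) = w (t' + k%:Z).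
Proof.
have [_ _ _ _ [fwd _]] := het; move=> tt' t0; have t'0 := het_pos tt' t0.
elim: k => [|k IH]; first by rewrite !addr0.
have E (a : int) : a + k.+1%:Z = a + k%:Z + 1 by lia.
by rewrite !E; apply: fwd => //; lia.
Qed.

Lemma het_bwd (t t' : int) (k : nat) : w t = w t' -> t <= 0 -> w (t - k%:Z) = w (t' - k%:Z).
Proof.
have [_ _ _ _ [_ bwd]] := het; move=> tt' t0.
have t'0 : t' <= 0.
  by rewrite leNgt; apply/negP => /(het_pos (esym tt')); lia.
elim: k => [|k IH]; first by rewrite !subr0.
have E (a : int) : a - k.+1%:Z = a - k%:Z - 1 by lia.
by rewrite !E; apply: bwd => //; lia.
Qed.

(** A walk is extended by an edge of the orbit.  If this edge lies in the future,
    the position found so far remains good since the future is determined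
    forwards; otherwise the whole walk lies in the past of the head of the edge
    and is determined by it. *)
Lemma het_factor (a : nat -> 'I_n) (L : nat) :
  (forall k, (k < L)%N -> M (a k) (a k.+1) != 0%N) ->
  exists c : int, forall k, (k <= L)%N -> a k = w (c + k%:Z).
Proof.
have [surj _ _ edges _] := het.
elim: L => [_|L IH walk].
  have [c wc] := surj (a 0%N); exists c => k; rewrite leqn0 => /eqP ->.
  by rewrite addr0.
have [k kL|c cP] := IH; first by apply: walk; exact: ltnW.
have [t [Lt L1t]] := edges _ _ (walk L (ltnSn L)).
have ct : w t = w (c + L%:Z) by rewrite -cP.
have [t0|t0] := ltP 0 t.
  exists c => k; rewrite leq_eqVlt => /orP [/eqP ->|]; last by rewrite ltnS; exact: cP.
  have -> : c + L.+1%:Z = c + L%:Z + 1%N%:Z by lia.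
  by rewrite L1t -(het_fwd 1 ct).
exists (t - L%:Z) => k; rewrite leq_eqVlt => /orP [/eqP ->|].
  by rewrite L1t; congr w; lia.
rewrite ltnS => kL; rewrite cP //.
have -> : c + k%:Z = c + L%:Z - (L - k)%N%:Z by lia.
by rewrite -(het_bwd _ ct) //; congr w; lia.
Qed.

Lemma het_le1 u u' : (M u u' <= 1)%N.
Proof.
have [_ _ one edges _] := het.
have [->//|/edges [t [-> ->]]] := eqVneq (M u u') 0%N.
by rewrite one.
Qed.
End Heteroclinic.

Definition entry_sum n (A : 'M[nat]_n) : nat := (\sum_u \sum_w A u w)%N.

(** There are [n + 1] edges: one leaving each vertex of the future, one entering
    each vertex of the past, and the edge from [w 0] to [w 1]. *)
Lemma het_entry_sum n (M : 'M[nat]_n) w : heteroclinic M w -> (entry_sum M <= n.+1)%N.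
Proof.
move=> het; have [surj _ one edges _] := het.
have [tm tmP] := choice surj.
pose f u := w (tm u + 1); pose g u := w (tm u - 1).
have bound u u' : (M u u' <= (0 < tm u)%R * (u' == f u) +
    (tm u' <= 0)%R * (u == g u') + (u == w 0) * (u' == w 1))%N.
  have [->//|ne0] := eqVneq (M u u') 0%N.
  apply: leq_trans (het_le1 het u u') _.
  have [t [ut u't]] := edges _ _ ne0.
  have [tu0|tu0] /= := ltP 0 (tm u).
    rewrite u't /f; have := het_fwd het 1 (etrans (tmP u) ut) tu0.
    by move=> ->; rewrite eqxx; lia.
  have t_le0 : t <= 0.
    by rewrite leNgt; apply/negP => /(het_pos het (esym (etrans (tmP u) ut))); lia.
  have [tu'0|tu'0] /= := leP (tm u') 0.
    rewrite ut /g; have := het_bwd het 1 (etrans (tmP u') u't) tu'0.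
    by move=> ->; rewrite addrK eqxx; lia.
  have t1 := het_pos het (etrans (tmP u') u't) tu'0.
  have t0 : t = 0 by lia.
  by rewrite ut u't t0 add0r !eqxx; lia.
apply: leq_trans (_ : (\sum_u \sum_u' _ <= _)%N).
  by apply: leq_sum => u _; apply: leq_sum => u' _; exact: bound.
have E (b : bool) (c : 'I_n) : (\sum_u b * (u == c) = b)%N.
  by rewrite (bigD1 c) //= eqxx muln1 big1 ?addn0 // => u /negbTE ->; rewrite muln0.
under eq_bigr => u _ do rewrite !big_split /= !E.
rewrite !big_split /= (exchange_big_dep predT) //=.
under [X in (_ + X + _)%N]eq_bigr => u _ do rewrite E.
have -> : (\sum_u (u == w 0) = 1)%N.
  by have := E true (w 0); under eq_bigr => u _ do rewrite mul1n.
rewrite -big_split /= addn1 ltnS -[n in (_ <= n)%N]card_ord -sum1_card.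
by apply: leq_sum => u _; case: (ltP 0 (tm u)).
Qed.

(** The entries of [A *m B] add up to the sum over [t] of the products
    [a_t b_t] of a column sum of [A] and a row sum of [B], and
    [a_t + b_t <= a_t b_t + 1] for positive integers. *)
Lemma entry_sum_mul n (A B : 'M[nat]_n) :
  (forall t, exists u, A u t != 0%N) -> (forall t, exists u, B t u != 0%N) ->
  (entry_sum A + entry_sum B <= entry_sum (A *m B) + n)%N.
Proof.
move=> Ac Br.
have -> : entry_sum (A *m B) = (\sum_t (\sum_u A u t) * (\sum_u B t u))%N.
  rewrite /entry_sum; under eq_bigr => u _ do under eq_bigr => u' _ do rewrite mxE.
  transitivity (\sum_u \sum_t A u t * (\sum_u' B t u'))%N.
    apply: eq_bigr => u _; rewrite exchange_big /=; apply: eq_bigr => t _.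
    by rewrite big_distrr.
  by rewrite exchange_big /=; apply: eq_bigr => t _; rewrite big_distrl.
rewrite {1}/entry_sum exchange_big /= -big_split /=.
rewrite -[n in (_ <= _ + n)%N]card_ord -sum1_card -big_split /=.
apply: leq_sum => t _.
have [u Au] := Ac t; have [u' Bu'] := Br t.
have le_mul (a b : nat) : (0 < a)%N -> (0 < b)%N -> (a + b <= a * b + 1)%N by nia.
apply: le_mul; first by rewrite (bigD1 u) //= addn_gt0 lt0n Au.
by rewrite (bigD1 u') //= addn_gt0 lt0n Bu'.
Qed.

Lemma entry_sum_ge n (A : 'M[nat]_n) :
  (forall t, exists u, A t u != 0%N) -> (n <= entry_sum A)%N.
Proof.
move=> Ar; rewrite -[n in (n <= _)%N]card_ord -sum1_card; apply: leq_sum => t _.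
by have [u Au] := Ar t; rewrite (bigD1 u) //= -lt0n in Au *; lia.
Qed.

Lemma entry_sum_tr n (A : 'M[nat]_n) : entry_sum A^T = entry_sum A.
Proof.
rewrite /entry_sum exchange_big /=; apply: eq_bigr => u _; apply: eq_bigr => u' _.
by rewrite mxE.
Qed.

(** With only [n] edges and at least one edge leaving each vertex, no vertex can
    have two. *)
Lemma entry_sum_functional n (e : rel 'I_n) : (forall t, exists u, e t u) ->
  entry_sum (adjmx e) = n -> forall u w w', e u w -> e u w' -> w = w'.
Proof.
move=> er en u w w' uw uw'; apply/eqP; apply: contraT => ww'.
suff : (n < entry_sum (adjmx e))%N by rewrite en ltnn.
rewrite /entry_sum (bigD1 u) //= -[n in (n < _)%N]card_ord -sum1_card (bigD1 u) //=.
apply: (@leq_ltn_trans (1 + \sum_(i < n | i != u) \sum_j adjmx e i j)%N).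
  rewrite leq_add2l; apply: leq_sum => t _; have [t' tt'] := er t.
  by rewrite (bigD1 t') //= mxE tt'.
rewrite ltn_add2r (bigD1 w) //= (bigD1 w') 1?eq_sym //= !mxE uw uw'; lia.
Qed.

(** * Points are determined by their diagonals *)

Lemma walk_pow n (e : rel 'I_n) (a : nat -> 'I_n) (k : nat) :
  (forall i, (i < k)%N -> e (a i) (a i.+1)) -> (adjmx e ^+ k) (a 0%N) (a k) != 0%N.
Proof.
elim: k => [_|k IH walk]; first by rewrite expr0 mxE eqxx.
rewrite exprSr; apply: (@mul_neq0 _ _ _ _ (a k)); last by rewrite mxE walk.
by apply: IH => i ik; apply: walk; exact: ltnW.
Qed.

Lemma mul_le1 n (A B : 'M[nat]_n) u t w : ((A *m B) u w <= 1)%N ->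
  A u t != 0%N -> B t w != 0%N -> (A u t <= 1)%N /\ (B t w <= 1)%N.
Proof.
rewrite mxE (bigD1 t) //= /GRing.add /= /GRing.mul /=.
by move: (A u t) (B t w) (\sum_(_ | _) _) => a b c; nia.
Qed.

Lemma mul_le1_uniq n (A B : 'M[nat]_n) u t t' w : ((A *m B) u w <= 1)%N ->
  A u t != 0%N -> B t w != 0%N -> A u t' != 0%N -> B t' w != 0%N -> t = t'.
Proof.
move=> le1 At Bt At' Bt'; apply/eqP; apply: contraT => tt'; move: le1.
rewrite mxE (bigD1 t) //= (bigD1 t') 1?eq_sym //= /GRing.add /= /GRing.mul /=.
move: At Bt At' Bt'.
by move: (A u t) (B t w) (A u t') (B t' w) (\sum_(_ | _) _) => a b a' b' c; nia.
Qed.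

(** Two different walks would contribute 2 to the entry of [e^k]. *)
Lemma walk_unique n (e : rel 'I_n) (a b : nat -> 'I_n) (k : nat) :
  (forall i, (i < k)%N -> e (a i) (a i.+1)) ->
  (forall i, (i < k)%N -> e (b i) (b i.+1)) ->
  a 0%N = b 0%N -> a k = b k -> ((adjmx e ^+ k) (a 0%N) (a k) <= 1)%N ->
  forall i, (i <= k)%N -> a i = b i.
Proof.
elim: k a b => [|k IH] a b wa wb ab0 abk; first by move=> _ i; rewrite leqn0 => /eqP ->.
have wa' i : (i < k)%N -> e (a i.+1) (a i.+2) by move=> ik; exact: wa.
have wb' i : (i < k)%N -> e (b i.+1) (b i.+2) by move=> ik; exact: wb.
rewrite exprS => le1.
have Aa : adjmx e (a 0%N) (a 1%N) != 0%N by rewrite mxE wa.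
have Ab : adjmx e (a 0%N) (b 1%N) != 0%N by rewrite mxE ab0 wb.
have Ba := walk_pow wa'; have Bb := walk_pow wb'.
have ab1 : a 1%N = b 1%N.
  by apply: (mul_le1_uniq le1 Aa _ Ab); rewrite // abk.
have [_ le1'] := mul_le1 le1 Aa Ba.
case=> [_ //|i ik]; exact: (IH (fun i => a i.+1) (fun i => b i.+1)).
Qed.

(** On a finite set where every vertex has a successor and a predecessor this
    says that [e] is the graph of a permutation. *)
Definition bifunctional (A : Type) (e : rel A) : Prop :=
  (forall u w w', e u w -> e u w' -> w = w') /\
  (forall u u' w, e u w -> e u' w -> u = u').

Lemma bifunctional_row (A : Type) (h v : rel A) x y p0 q :
  bifunctional h -> admissible h v x -> admissible h v y ->
  x (p0, q) = y (p0, q) -> forall p, x (p, q) = y (p, q).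
Proof.
move=> [fw bw] xP yP xy0 p.
have step p1 : x (p1, q) = y (p1, q) <-> x (p1 + 1, q) = y (p1 + 1, q).
  have [hx _] := xP p1 q; have [hy _] := yP p1 q; split=> E.
    by move: hx; rewrite E => hx; exact: fw hx hy.
  by move: hx; rewrite E => hx; exact: bw hx hy.
have up k : x (p0 + k%:Z, q) = y (p0 + k%:Z, q).
  elim: k => [|k IH]; first by rewrite addr0.
  have -> : p0 + k.+1%:Z = p0 + k%:Z + 1 by lia.
  exact: (step _).1.
have down k : x (p0 - k%:Z, q) = y (p0 - k%:Z, q).
  elim: k => [|k IH]; first by rewrite subr0.
  by apply: (step _).2; have -> : p0 - k.+1%:Z + 1 = p0 - k%:Z by lia.
have [pp0|pp0] := leP p0 p.
  by have := up (absz (p - p0)); have -> : p0 + (absz (p - p0))%:Z = p by lia.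
by have := down (absz (p - p0)); have -> : p0 - (absz (p - p0))%:Z = p by lia.
Qed.

Lemma bifunctional_col (A : Type) (h v : rel A) x y p q0 :
  bifunctional v -> admissible h v x -> admissible h v y ->
  x (p, q0) = y (p, q0) -> forall q, x (p, q) = y (p, q).
Proof.
move=> vP /admissible_transpose xP /admissible_transpose yP.
exact: bifunctional_row vP xP yP.
Qed.

Lemma entry_sum_bifunctional n (e : rel 'I_n) :
  (forall t, exists u, e t u) -> (forall t, exists u, e u t) ->
  entry_sum (adjmx e) = n -> bifunctional e.
Proof.
move=> er ec en; split; first exact: entry_sum_functional.
move=> u u' w uw u'w.
apply: (@entry_sum_functional n (fun a b => e b a) ec _ w) => //.
by rewrite -[RHS]en -entry_sum_tr; congr entry_sum; apply/matrixP => i j; rewrite !mxE.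
Qed.

Section HeteroclinicTransitive.
Variables (n : nat) (h v : rel 'I_n).
Hypothesis hv : commuting h v.
Hypothesis occurs : forall a, exists2 x, admissible h v x & x (0, 0) = a.
Variables (r s : nat).
Hypotheses (r_gt0 : (0 < r)%N) (s_gt0 : (0 < s)%N).
Let M : 'M[nat]_n := adjmx h ^+ r *m adjmx v ^+ s.
Local Notation X := (admissible h v).
Local Notation diag := (@diag n r s).

Lemma represents_M : represents h v M r s.
Proof.
have := represents_mul hv (represents_exp hv occurs r (represents_h hv occurs))
  (represents_exp hv occurs s (represents_v hv occurs)).
by rewrite !muln1 !muln0 addn0.
Qed.
Let MP := represents_M.

Lemma represents_out (A : 'M[nat]_n) a b : represents h v A a b ->
  forall t, exists u, A t u != 0%N.
Proof.
move=> AP t; have [x xP <-] := occurs t.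
by exists (x (a%:Z, b%:Z)); exact: represents_sound AP _ xP.
Qed.

Lemma represents_in (A : 'M[nat]_n) a b : represents h v A a b ->
  forall w, exists u, A u w != 0%N.
Proof.
move=> AP w; have [x xP <-] := occurs w; exists (x (- a%:Z, - b%:Z)).
have := represents_sound_at (- a%:Z) (- b%:Z) AP xP.
by rewrite !addNr.
Qed.

Lemma entry_sum_exp (A : 'M[nat]_n) a b k : represents h v A a b ->
  (entry_sum A <= entry_sum (A ^+ k.+1))%N.
Proof.
move=> AP; elim: k => [|k IH]; first by rewrite expr1.
have Ak := represents_exp hv occurs k.+1 AP.
have := entry_sum_mul (represents_in AP) (represents_out Ak).
by rewrite mulmxE -exprS in Ak *; have := entry_sum_ge (represents_out Ak); lia.
Qed.

Lemma realize_walk (a : nat -> 'I_n) (L : nat) :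
  (forall k, (k < L)%N -> M (a k) (a k.+1) != 0%N) ->
  exists2 z, X z & forall k, (k <= L)%N -> diag z k%:Z = a k.
Proof.
elim: L => [_|L IH walk].
  have [z zP za] := occurs (a 0%N); exists z => // k; rewrite leqn0 => /eqP ->.
  by rewrite diag0.
have [k kL|z zP za] := IH; first by apply: walk; exact: ltnW.
have [y [yP y0 y1]] := realize_edge_diag hv occurs MP (walk L (ltnSn L)).
have [|c [cP cz cy]] := @splice n h v hv r s r_gt0 s_gt0 z y L%:Z 0 zP yP.
  by rewrite za.
exists c => // k; rewrite leq_eqVlt => /orP [/eqP ->|kL].
  by rewrite cy -?y1; [congr (diag y _); lia | lia].
by rewrite cz ?za //; lia.
Qed.

(** The number of edges of [h] and that of [v] add up to at most [2 n + 1], and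
    neither is less than [n]. *)
Lemma heteroclinic_bifunctional w : heteroclinic M w -> bifunctional h \/ bifunctional v.
Proof.
move=> het.
have hP := represents_h hv occurs; have vP := represents_v hv occurs.
have tM := het_entry_sum het.
have hrP := represents_exp hv occurs r hP; have vsP := represents_exp hv occurs s vP.
have := entry_sum_mul (represents_in hrP) (represents_out vsP); rewrite -/M => tmul.
have th : (entry_sum (adjmx h) <= entry_sum (adjmx h ^+ r))%N.
  by rewrite -(prednK r_gt0); exact: entry_sum_exp hP.
have tv : (entry_sum (adjmx v) <= entry_sum (adjmx v ^+ s))%N.
  by rewrite -(prednK s_gt0); exact: entry_sum_exp vP.
have nh := entry_sum_ge (represents_out hP); have nv := entry_sum_ge (represents_out vP).
have adjE (e : rel 'I_n) u u' : adjmx e u u' != 0%N -> e u u'.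
  by rewrite mxE; case: (e u u').
have [hn|hn] := eqVneq (entry_sum (adjmx h)) n; [left|right].
- apply: entry_sum_bifunctional => // t.
    by have [u /adjE] := represents_out hP t; exists u.
  by have [u /adjE] := represents_in hP t; exists u.
- apply: entry_sum_bifunctional => [t|t|].
  + by have [u /adjE] := represents_out vP t; exists u.
  + by have [u /adjE] := represents_in vP t; exists u.
  + by apply/eqP; rewrite eqn_leq nv andbT; move: hn; rewrite neq_ltn; lia.
Qed.

(** Position of a row (or column) with respect to the steps of the diagonal; the
    bound on [k] keeps these steps inside the window of [diag_determines]. *)
Lemma floor_int (q : int) (d : nat) : (0 < d)%N ->
  exists (k : int) (i : nat), [/\ q = k * d%:Z + i%:Z, (i <= d)%N & `|k| <= `|q| ].
Proof.
move=> d0; have dz0 : d%:Z != 0 by lia.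
exists (q %/ d%:Z)%Z, (absz (q %% d%:Z)%Z).
have m0 := modz_ge0 q dz0; have md : (q %% d%:Z)%Z < d%:Z by apply: ltz_pmod; lia.
have E := divz_eq q d%:Z.
move: (q %/ d%:Z)%Z (q %% d%:Z)%Z m0 md E => k m m0 md ->.
split; [lia | lia | nia].
Qed.

(** Each row meets the vertical part, and each column the horizontal part, of the
    staircase that joins consecutive points of the diagonal.  The staircase is
    determined by the diagonal because the entries of [M] are at most 1, and one
    symbol determines the row when [h] is bifunctional, the column when [v] is. *)
Lemma diag_determines x y (j : nat) :
  (forall u u', (M u u' <= 1)%N) -> bifunctional h \/ bifunctional v ->
  X x -> X y ->
  (forall k : int, - j.+1%:Z <= k <= j.+1%:Z -> diag x k = diag y k) ->
  agree_on_box j x y.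
Proof.
move=> M1 bif xP yP xy p q pj qj.
have Hx z k : X z -> (adjmx h ^+ r) (diag z k) (z ((k + 1) * r%:Z, k * s%:Z)) != 0%N.
  move=> zP; have hrP := represents_exp hv occurs r (represents_h hv occurs).
  have := represents_sound_at (k * r%:Z) (k * s%:Z) hrP zP; rewrite muln1 muln0 addr0.
  by have -> : k * r%:Z + r%:Z = (k + 1) * r%:Z by lia.
have Vx z k : X z -> (adjmx v ^+ s) (z ((k + 1) * r%:Z, k * s%:Z)) (diag z (k + 1)) != 0%N.
  move=> zP; have vsP := represents_exp hv occurs s (represents_v hv occurs).
  have := represents_sound_at ((k + 1) * r%:Z) (k * s%:Z) vsP zP; rewrite muln1 muln0 addr0.
  by have -> : k * s%:Z + s%:Z = (k + 1) * s%:Z by lia.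
case: bif => bif.
- have [k [i [qE ir kq]]] := floor_int q s_gt0.
  apply: (@bifunctional_row _ h v _ _ ((k + 1) * r%:Z) _ bif xP yP).
  have corner : x ((k + 1) * r%:Z, k * s%:Z) = y ((k + 1) * r%:Z, k * s%:Z).
    by apply: (@bifunctional_row _ h v _ _ (k * r%:Z) _ bif xP yP); apply: xy; lia.
  have [_ le1] := mul_le1 (M1 _ _) (Hx x k xP) (Vx x k xP).
  pose col (z : int * int -> 'I_n) (m : nat) := z ((k + 1) * r%:Z, k * s%:Z + m%:Z).
  have colw z : X z -> forall m, (m < s)%N -> v (col z m) (col z m.+1).
    move=> zP m _; have [_] := zP ((k + 1) * r%:Z) (k * s%:Z + m%:Z).
    by rewrite /col; have -> : k * s%:Z + m%:Z + 1 = k * s%:Z + m.+1%:Z by lia.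
  have col0 z : col z 0%N = z ((k + 1) * r%:Z, k * s%:Z) by rewrite /col addr0.
  have cols z : col z s = diag z (k + 1) by congr (z (_, _)); lia.
  have := walk_unique (colw x xP) (colw y yP); rewrite !col0 !cols.
  by move=> /(_ corner _ le1 i ir); rewrite /col -qE; apply; apply: xy; lia.
- have [k [i [pE ir kp]]] := floor_int p r_gt0.
  apply: (@bifunctional_col _ h v _ _ _ (k * s%:Z) bif xP yP).
  have corner : x ((k + 1) * r%:Z, k * s%:Z) = y ((k + 1) * r%:Z, k * s%:Z).
    by apply: (@bifunctional_col _ h v _ _ _ ((k + 1) * s%:Z) bif xP yP); apply: xy; lia.
  have [le1 _] := mul_le1 (M1 _ _) (Hx x k xP) (Vx x k xP).
  pose row (z : int * int -> 'I_n) (m : nat) := z (k * r%:Z + m%:Z, k * s%:Z).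
  have roww z : X z -> forall m, (m < r)%N -> h (row z m) (row z m.+1).
    move=> zP m _; have [+ _] := zP (k * r%:Z + m%:Z) (k * s%:Z).
    by rewrite /row; have -> : k * r%:Z + m%:Z + 1 = k * r%:Z + m.+1%:Z by lia.
  have row0 z : row z 0%N = diag z k by rewrite /row addr0.
  have rowr z : row z r = z ((k + 1) * r%:Z, k * s%:Z) by congr (z (_, _)); lia.
  have := walk_unique (roww x xP) (roww y yP); rewrite !row0 !rowr.
  by move=> /(_ _ corner le1 i ir); rewrite /row -pE; apply; apply: xy; lia.
Qed.

(** The windows of both diagonals occur in [w], and any finite stretch of [w] is
    realized as the diagonal of a point [z].  The window is one step larger than
    the box, as [diag_determines] requires. *)
Lemma heteroclinic_box_transitive w :
  heteroclinic M w -> box_transitive r%:Z s%:Z X.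
Proof.
move=> het; have bif := heteroclinic_bifunctional het.
have M1 := het_le1 het; have [_ _ one _ _] := het.
move=> j x y xP yP.
have window t : X t -> exists c : int, forall k : int,
    - j.+1%:Z <= k <= j.+1%:Z -> diag t k = w (c + k).
  move=> tP.
  have [k _|c cP] :=
    @het_factor n M w het (fun k => diag t (k%:Z - j.+1%:Z)) (j.+1).*2.
    have -> : k.+1%:Z - j.+1%:Z = k%:Z - j.+1%:Z + 1 by lia.
    exact: (diag_edge hv occurs MP (k%:Z - j.+1%:Z) tP).
  exists (c + j.+1%:Z) => k kj; have := cP (absz (k + j.+1%:Z)).
  have -> : (absz (k + j.+1%:Z))%:Z - j.+1%:Z = k by lia.
  by move=> ->; [congr w|]; lia.
have [c1 c1P] := window x xP; have [c2 c2P] := window y yP.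
pose lo := Num.min c1 c2 - j.+1%:Z.
have [k _|z zP zw] := @realize_walk (fun k => w (lo + k%:Z)) (absz (c1 - c2) + (j.+1).*2)%N.
  have -> : lo + k.+1%:Z = lo + k%:Z + 1 by lia.
  by rewrite one.
have zE m : lo <= m <= Num.max c1 c2 + j.+1%:Z -> diag z (m - lo) = w m.
  move=> mlo; have := zw (absz (m - lo)).
  have -> : (absz (m - lo))%:Z = m - lo by lia.
  by move=> ->; [congr w|]; lia.
exists (c2 - c1), (fun a => z (a + ((c1 - lo) * r%:Z, (c1 - lo) * s%:Z))); split.
- exact: admissible_shift.
- apply: diag_determines => //; first exact: admissible_shift.
  move=> k kj; rewrite diag_shift c1P //.
  have -> : c1 - lo + k = c1 + k - lo by lia.
  by rewrite zE //; lia.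
- apply: diag_determines => //.
    by apply: (@admissible_shift _ h v _ (fun a => z (a + _))); exact: admissible_shift.
  move=> k kj; rewrite (@diag_shift n r s (fun a => z (a + _))) diag_shift c2P //.
  have -> : c1 - lo + (c2 - c1 + k) = c2 + k - lo by lia.
  by rewrite zE //; lia.
Qed.
End HeteroclinicTransitive.

(** * A heteroclinic orbit joins two cycles *)

Lemma trmx_exp_nat n (A : 'M[nat]_n) k : (A ^+ k)^T = A^T ^+ k.
Proof.
elim: k => [|k IH]; first by rewrite !expr0 trmx1.
rewrite exprS exprSr -IH; apply/matrixP => i j; rewrite !mxE.
by apply: eq_bigr => t _; rewrite !mxE mulrC.
Qed.

Lemma irreducible_mx_tr n (A : 'M[nat]_n) : irreducible_mx A -> irreducible_mx A^T.
Proof.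
move=> irr i j; have [k k0 ji] := irr j i; exists k => //.
by rewrite -trmx_exp_nat mxE.
Qed.

Lemma principal_submx_tr n (M : 'M[nat]_n) (S : {set 'I_n}) :
  principal_submx M^T S = (principal_submx M S)^T.
Proof. by apply/matrixP => i j; rewrite !mxE. Qed.

Lemma irreducible_submx_tr n (M : 'M[nat]_n) (S : {set 'I_n}) :
  irreducible_submx M S -> irreducible_submx M^T S.
Proof. by move=> [S0 irr]; split=> //; rewrite principal_submx_tr; exact: irreducible_mx_tr. Qed.

(** Reversing time exchanges the past and the future, so that only cycles in the
    future need to be studied. *)
Lemma heteroclinic_tr n (M : 'M[nat]_n) w :
  heteroclinic M w -> heteroclinic M^T (fun t => w (1 - t)).
Proof.
move=> [surj sep one edges [fwd bwd]]; split.
- by move=> u; have [t <-] := surj u; exists (1 - t); congr w; lia.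
- by move=> t t' t0 t'0 E; apply: (sep (1 - t') (1 - t)); [lia | lia |].
- move=> t; rewrite mxE -(one (1 - (t + 1))).
  by congr (M _ (w _)); lia.
- move=> u u'; rewrite mxE => /edges [t [-> ->]]; exists (- t).
  by split; congr w; lia.
- split=> t t' t0 t'0 E.
  + have -> : 1 - (t + 1) = 1 - t - 1 by lia.
    have -> : 1 - (t' + 1) = 1 - t' - 1 by lia.
    by apply: bwd => //; lia.
  + have -> : 1 - (t - 1) = 1 - t + 1 by lia.
    have -> : 1 - (t' - 1) = 1 - t' + 1 by lia.
    by apply: fwd => //; lia.
Qed.

Lemma pow_walkP n (M : 'M[nat]_n) u w k : (M ^+ k) u w != 0%N <->
  exists a : nat -> 'I_n, [/\ a 0%N = u, a k = w &
    forall i, (i < k)%N -> M (a i) (a i.+1) != 0%N].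
Proof.
split=> [|[a [<- <- walk]]].
- elim: k w => [|k IH] w.
    rewrite expr0 mxE; have [<- _|] := eqVneq u w; last by rewrite eqxx.
    by exists (fun=> u).
  rewrite exprSr => /sum_mul_neq0 [t /IH [a [a0 ak walk]] tw].
  exists (fun i => if (i <= k)%N then a i else w); split=> // [|i].
    by rewrite ltnn.
  rewrite ltnS => ik; rewrite ik; have [ik'|ki] := ltnP i k; first exact: walk.
  have -> : i = k by lia.
  by rewrite ak.
- elim: k walk => [_|k IH walk]; first by rewrite expr0 mxE eqxx.
  rewrite exprSr; apply: (@mul_neq0 _ _ _ _ (a k)); last exact: walk.
  by apply: IH => i ik; apply: walk; exact: ltnW.
Qed.

Lemma irreducible_submxP n (M : 'M[nat]_n) (S : {set 'I_n}) :
  irreducible_submx M S <-> S != finset.set0 /\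
  forall u w, u \in S -> w \in S -> exists (k : nat) (a : nat -> 'I_n),
    [/\ (0 < k)%N, a 0%N = u, a k = w, forall i, (i <= k)%N -> a i \in S
      & forall i, (i < k)%N -> M (a i) (a i.+1) != 0%N].
Proof.
split=> -[S0 irr]; split=> //.
- move=> u w uS wS.
  have [k k0 /pow_walkP [a [a0 ak walk]]] := irr (enum_rank_in uS u) (enum_rank_in wS w).
  exists k, (fun i => enum_val (a i)); split=> //.
  + by rewrite a0 enum_rankK_in.
  + by rewrite ak enum_rankK_in.
  + by move=> i _; exact: enum_valP.
  + by move=> i /walk; rewrite mxE.
- move=> i j.
  have [k [a [k0 a0 ak aS walk]]] := irr _ _ (enum_valP i) (enum_valP j).
  exists k => //; apply/pow_walkP.
  exists (fun m => enum_rank_in (enum_valP i) (a m)); split.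
  + by rewrite a0 enum_valK_in.
  + by rewrite ak enum_valK_in.
  + move=> m mk; rewrite mxE !enum_rankK_in ?aS //; last by exact: ltnW.
    exact: walk.
Qed.

(** The vertices of the cycle into which the future of [w] runs. *)
Definition recurrent n (w : int -> 'I_n) : {set 'I_n} :=
  [set u | `[< exists t t', [/\ 0 < t, t < t', w t = u & w t' = u] >]]%SET.

Section Recurrent.
Variables (n : nat) (M : 'M[nat]_n) (w : int -> 'I_n).
Hypothesis het : heteroclinic M w.

Lemma recurrentP u : u \in recurrent w <->
  exists t t', [/\ 0 < t, t < t', w t = u & w t' = u].
Proof. by rewrite inE; split=> /asboolP. Qed.

Lemma recurrent_neq0 : recurrent w != finset.set0.
Proof.
have : ~~ injectiveb (fun i : 'I_n.+1 => w i.+1%:Z).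
  apply/negP => /injectiveP /leq_card; rewrite !card_ord; lia.
case/injectivePn => i [j ij E]; apply/set0Pn; exists (w i.+1%:Z).
have ne : i != j :> nat := ij.
apply/recurrentP; have [lt|ge] := ltnP i j.
  by exists i.+1%:Z, j.+1%:Z; split=> //; lia.
by exists j.+1%:Z, i.+1%:Z; split=> //; lia.
Qed.

Lemma recurrent_fwd (t t' : int) : 0 < t -> t <= t' -> w t \in recurrent w ->
  w t' \in recurrent w.
Proof.
move=> t0 tt' /recurrentP [t1 [t2 [t10 t12 E1 E2]]]; apply/recurrentP.
pose m := absz (t' - t); exists (t1 + m%:Z), (t2 + m%:Z); split; [lia | lia | |].
- by rewrite (het_fwd het m E1 t10); congr w; lia.
- by rewrite (het_fwd het m E2) ; [congr w; lia | lia].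
Qed.

Lemma het_period (t : int) (d m i : nat) : 0 < t -> w t = w (t + d%:Z) ->
  w (t + (m * d + i)%N%:Z) = w (t + i%:Z).
Proof.
move=> t0 E; elim: m => [|m IH]; first by rewrite mul0n add0n.
rewrite -IH; have := het_fwd het (m * d + i)%N E t0 => ->.
by congr w; lia.
Qed.

Lemma recurrent_late u (t0 : int) : u \in recurrent w ->
  exists t, [/\ t0 <= t, 0 < t & w t = u].
Proof.
move=> /recurrentP [t [t' [t_gt0 tt' <- E]]].
exists (t + (absz t0 * absz (t' - t) + 0)%N%:Z); split; [nia | nia |].
rewrite het_period ?addr0 // -E; congr w; lia.
Qed.

Lemma recurrent_pos (t : int) : w t \in recurrent w -> 0 < t.
Proof. by move=> /recurrentP [t1 [_ [t10 _ E _]]]; exact: (het_pos het E t10). Qed.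

Lemma recurrent_period (t : int) : 0 < t -> w t \in recurrent w ->
  exists2 d : nat, (0 < d)%N & w t = w (t + d%:Z).
Proof.
move=> t0 /recurrentP [t1 [t2 [t1_gt0 t12 E1 E2]]]; exists (absz (t2 - t1)); first lia.
rewrite -(het_fwd het _ E1 t1_gt0) -[LHS]E2; congr w; lia.
Qed.

Lemma recurrent_irreducible : irreducible_submx M (recurrent w).
Proof.
have [_ _ one _ _] := het.
apply/irreducible_submxP; split; first exact: recurrent_neq0.
move=> u u' uR uR'; have [t [_ t0 tu]] := recurrent_late 0 uR.
rewrite -tu in uR *.
have [t' [tt' _ tu']] := recurrent_late (t + 1) uR'.
pose k := absz (t' - t); exists k, (fun i => w (t + i%:Z)); split.
- lia.
- by rewrite addr0.
- by rewrite -tu'; congr w; lia.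
- by move=> i _; apply: recurrent_fwd uR; lia.
- move=> i _; have -> : t + i.+1%:Z = t + i%:Z + 1 by lia.
  by rewrite one.
Qed.

Lemma het_next (t : int) u : 0 < t -> M (w t) u != 0%N -> u = w (t + 1).
Proof.
have [_ _ _ edges _] := het; move=> t0 /edges [t' [E ->]].
by rewrite -(het_fwd het 1 E t0).
Qed.

(** On the cycle the successor map is injective, since a common period of two
    vertices allows to recover them from their successors. *)
Lemma recurrent_perm : is_perm_mx (principal_submx M (recurrent w)).
Proof.
have [_ _ one _ _] := het.
have nextP u : u \in recurrent w -> exists u', [/\ u' \in recurrent w, M u u' = 1%N &
    forall v, M u v != 0%N -> v = u'].
  move=> uR; have [t [_ t0 tu]] := recurrent_late 0 uR; exists (w (t + 1)).
  rewrite -tu one; split=> // [|v]; last exact: het_next.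
  by apply: recurrent_fwd t0 _ _; rewrite ?tu //; lia.
have next_inj u u' v : u \in recurrent w -> u' \in recurrent w ->
    M u v != 0%N -> M u' v != 0%N -> u = u'.
  move=> uR u'R; have [t1 [_ t1_gt0 tu]] := recurrent_late 0 uR.
  have [t2 [_ t2_gt0 tu']] := recurrent_late 0 u'R.
  rewrite -tu -tu' => /(het_next t1_gt0) -> /(het_next t2_gt0) E.
  rewrite -tu in uR; rewrite -tu' in u'R.
  have [d1 d1_gt0 E1] := recurrent_period t1_gt0 uR.
  have [d2 d2_gt0 E2] := recurrent_period t2_gt0 u'R.
  (* [d1 * d2] is a common period. *)
  rewrite -[t1]addr0 -[t2]addr0 -(het_period d2 0 t1_gt0 E1) -(het_period d1 0 t2_gt0 E2).
  have -> : t1 + (d2 * d1 + 0)%N%:Z = t1 + 1 + (d1 * d2).-1%:Z by nia.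
  have -> : t2 + (d1 * d2 + 0)%N%:Z = t2 + 1 + (d1 * d2).-1%:Z by nia.
  by apply: (het_fwd het) => //; lia.
have /choice [f fP] : forall i : 'I_#|recurrent w|, exists j : 'I_#|recurrent w|,
    M (enum_val i) (enum_val j) = 1%N /\ forall v, M (enum_val i) v != 0%N -> v = enum_val j.
  move=> i; have [u [uR iu uniq]] := nextP _ (enum_valP i).
  by exists (enum_rank_in uR u); rewrite enum_rankK_in.
have f_inj : injective f.
  move=> i i' E; apply: enum_val_inj.
  apply: (next_inj _ _ (enum_val (f i))); try exact: enum_valP.
  - by rewrite (fP i).1.
  - by rewrite E (fP i').1.
apply/is_perm_mxP; exists (perm f_inj); apply/matrixP => i j; rewrite !mxE permE.
have [<-|ne] := eqVneq (f i) j; first by rewrite (fP i).1.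
apply/eqP; apply: contraT => ij; case/eqP: ne.
by apply: enum_val_inj; rewrite [RHS]((fP i).2 _ ij).
Qed.

(** [S] carries a closed walk through [u].  As a stretch of the orbit it goes
    round the cycle, and every walk of [S] starting on the cycle stays there. *)
Lemma irreducible_sub_recurrent (S : {set 'I_n}) u :
  irreducible_submx M S -> u \in S -> u \in recurrent w -> S = recurrent w.
Proof.
move=> /irreducible_submxP [_ irr] uS uR; apply/setP => v; apply/idP/idP => [vS|vR].
- have [k [a [k0 a0 ak _ walk]]] := irr u v uS vS.
  have [c cP] := het_factor het walk.
  have wc : w c = u by rewrite -a0 cP // addr0.
  have c0 : 0 < c by apply: recurrent_pos; rewrite wc.
  rewrite -ak cP //; apply: (@recurrent_fwd c) => //; [lia | by rewrite wc].
- have [k [a [k0 a0 ak aS walk]]] := irr u u uS uS.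
  have [c cP] := het_factor het walk.
  have wc : w c = u by rewrite -a0 cP // addr0.
  have c0 : 0 < c by apply: recurrent_pos; rewrite wc.
  have wck : w c = w (c + k%:Z) by rewrite -cP // ak.
  have [t [ct t0 <-]] := recurrent_late c vR.
  have -> : t = c + (absz (t - c) %/ k * k + absz (t - c) %% k)%N%:Z.
    by rewrite -divn_eq; lia.
  have km := ltn_pmod (absz (t - c)) k0.
  by rewrite (het_period _ _ c0 wck) -cP ?aS //; exact: ltnW.
Qed.

Lemma irreducible_sub_pos (S : {set 'I_n}) (t : int) :
  irreducible_submx M S -> w t \in S -> 0 < t -> S = recurrent w.
Proof.
move=> Sirr tS t0; apply: (irreducible_sub_recurrent Sirr tS).
have /irreducible_submxP [_ irr] := Sirr.
have [k [a [k0 a0 ak _ walk]]] := irr _ _ tS tS.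
have [c cP] := het_factor het walk.
have wc : w c = w t by rewrite -a0 cP // addr0.
have c0 : 0 < c := (het_pos het (esym wc) t0).
by apply/recurrentP; exists c, (c + k%:Z); split; rewrite -?cP //; lia.
Qed.
End Recurrent.

Lemma mpath_labels n (M : 'M[nat]_n) i j (p : seq ('I_n * nat)) :
  (forall u v, (M u v <= 1)%N) -> is_mpath M i j p ->
  p = [seq (v, 0%N) | v <- [seq w.1 | w <- p]].
Proof.
move=> M1 /and3P [pp _ _].
have : path (fun u w : 'I_n * nat => (w.2 < M u.1 w.1)%N) (i, 0%N) p := pp.
elim: p (i, 0%N) {pp} => //= -[v e] p IH u /andP [/= ve /IH <-].
by congr ((_, _) :: _); have := M1 u.1 v; lia.
Qed.

Lemma mpath_step n (M : 'M[nat]_n) i j p : is_mpath M i j p ->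
  forall k, (k < size p)%N ->
    M (nth i (mpath_vertices i p) k) (nth i (mpath_vertices i p) k.+1) != 0%N.
Proof.
move=> /and3P [/(pathP (i, 0%N)) pp _ _] k kp.
have lt := pp k kp.
have -> : nth i (mpath_vertices i p) k = (nth (i, 0%N) ((i, 0%N) :: p) k).1.
  by case: k kp {lt} => [|k] kp //=; rewrite (nth_map (i, 0%N)) //; exact: ltnW.
rewrite /= (nth_map (i, 0%N)) // -lt0n.
exact: (leq_ltn_trans (leq0n _) lt).
Qed.

Lemma path_mpath n (M : 'M[nat]_n) i (q : seq 'I_n) :
  path (fun u v => M u v != 0%N) i q -> exists p, is_mpath M i (last i q) p.
Proof.
move=> iq; have [q' iq' uq' _] := shortenP iq.
exists [seq (v, 0%N) | v <- q']; rewrite /is_mpath /mpath_vertices.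
have E : [seq w.1 | w <- [seq (v, 0%N) | v <- q']] = q'.
  by rewrite -map_comp map_id_in.
rewrite E uq' eqxx !andbT.
elim: q' i iq' {iq uq' E} => //= v q' IH i /andP [iv /IH ->].
by rewrite andbT lt0n.
Qed.

(** [A1] is the cycle of the past and [A2] that of the future.  A path from [i]
    to [j] is a stretch of [w] between times [c <= 0 < c'] with [w c = i] and
    [w c' = j].  As a path has no repeated vertex, [c] is the last time at which
    the past visits [i] and [c'] the first time at which the future visits [j];
    this determines the path.  Vertices visited before [c] belong to [A1], those
    visited after [c'] to [A2]. *)
Lemma heteroclinic_joined n (M : 'M[nat]_n) w :
  heteroclinic M w -> two_cycles_joined M.
Proof.
move=> het; have [surj sep one edges _] := het; have hetT := heteroclinic_tr het.
pose w' t := w (1 - t); pose A1 := recurrent w'; pose A2 := recurrent w.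
have w'E t : w t = w' (1 - t) by congr w; lia.
have A1_neg t : w t \in A1 -> t <= 0.
  by rewrite w'E => /(recurrent_pos hetT); lia.
have A2_pos t : w t \in A2 -> 0 < t by move=> tR; exact: (recurrent_pos het tR).
exists A1, A2; split.
- move=> E; have /set0Pn [u] := recurrent_neq0 w; have [t <-] := surj u => tA.
  by have := A2_pos t tA; have := A1_neg t; rewrite E => /(_ tA); lia.
- split.
    by have := irreducible_submx_tr (recurrent_irreducible hetT); rewrite trmxK.
  by have := recurrent_perm hetT; rewrite principal_submx_tr is_perm_mx_tr.
- by split; [exact: recurrent_irreducible het | exact: recurrent_perm het].
- move=> S Sirr; have [/set0Pn [u uS] _] := Sirr; have [t tu] := surj u.
  have [t0|t0] := ltP 0 t; [right|left].
    by apply: (irreducible_sub_pos het Sirr _ t0); rewrite tu.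
  apply: (irreducible_sub_pos hetT (irreducible_submx_tr Sirr) (t := 1 - t)); last lia.
  by rewrite -/(w' (1 - t)) -w'E tu.
move=> i j iA1 jA2.
have [ti ti_w] := surj i; have [tj tj_w] := surj j.
have ti0 : ti <= 0 by apply: A1_neg; rewrite ti_w.
have tj0 : 0 < tj by apply: A2_pos; rewrite tj_w.
(* The path starts in the past and ends in the future. *)
have stretch p : is_mpath M i j p -> exists c : int,
    [/\ c <= 0, 0 < c + (size p)%:Z, w c = i, w (c + (size p)%:Z) = j
      & forall k, (k <= size p)%N -> nth i (mpath_vertices i p) k = w (c + k%:Z)].
  move=> pP; have [c cP] := het_factor het (mpath_step pP).
  have wc : w c = i by rewrite -[c]addr0 -cP.
  have wcs : w (c + (size p)%:Z) = j.
    case/and3P: pP => _ _ /eqP <-; rewrite -cP // (last_nth i) size_map //.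
  exists c; split=> //.
    by apply: A1_neg; rewrite wc.
  by apply: A2_pos; rewrite wcs.
have pnth_inj p k l : is_mpath M i j p -> (k <= size p)%N -> (l <= size p)%N ->
    nth i (mpath_vertices i p) k = nth i (mpath_vertices i p) l -> k = l.
  move=> /and3P [_ up _] kp lp /eqP; rewrite nth_uniq //= ?ltnS ?size_map //.
  by move/eqP.
have start p q c d : is_mpath M i j p -> is_mpath M i j q ->
    c <= 0 -> 0 < c + (size p)%:Z -> w c = i -> d <= 0 -> w d = i ->
    (forall k, (k <= size p)%N -> nth i (mpath_vertices i p) k = w (c + k%:Z)) ->
    d <= c.
  move=> pP qP c0 cp wc d0 wd pE; rewrite leNgt; apply/negP => cd.
  have := pnth_inj p (absz (d - c)) 0%N pP; rewrite !pE; try lia.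
  have -> : c + (absz (d - c))%:Z = d by lia.
  by rewrite addr0 wc wd => /(_ _ _ erefl); lia.
have stop p q c : is_mpath M i j p -> is_mpath M i j q ->
    (forall k, (k <= size p)%N -> nth i (mpath_vertices i p) k = w (c + k%:Z)) ->
    w (c + (size p)%:Z) = j -> w (c + (size q)%:Z) = j ->
    (size p <= size q)%N.
  move=> pP qP pE wp wq; rewrite leqNgt; apply/negP => qp.
  have := pnth_inj p (size p) (size q) pP; rewrite !pE ?wp ?wq //; try exact: ltnW.
  by move=> /(_ (leqnn _) (ltnW qp) erefl); lia.
have [p pP] : exists p, is_mpath M i j p.
  pose L := absz (tj - ti).
  have := @path_mpath n M i [seq w (ti + k.+1%:Z) | k <- iota 0 L].
  have -> : last i [seq w (ti + k.+1%:Z) | k <- iota 0 L] = j.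
    rewrite -nth_last size_map size_iota (nth_map 0%N) ?size_iota; last lia.
    by rewrite nth_iota -?tj_w; [congr w|]; lia.
  apply; apply/(pathP i) => k; rewrite size_map size_iota => kL.
  rewrite (nth_map 0%N) ?size_iota // nth_iota // add0n.
  have -> : nth i (i :: [seq w (ti + k0.+1%:Z) | k0 <- iota 0 L]) k = w (ti + k%:Z).
    case: k kL => [|k] kL /=; first by rewrite addr0.
    by rewrite (nth_map 0%N) ?size_iota ?nth_iota //; exact: ltnW.
  have -> : ti + k.+1%:Z = ti + k%:Z + 1 by lia.
  by rewrite one.
have [c [c0 cp wc wcp pE]] := stretch p pP.
exists p; split=> // [q qP|v].
- have [d [d0 dq wd wdq qE]] := stretch q qP.
  have dc : d = c.
    by apply/eqP; rewrite eq_le (start p q) // (start q p).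
  rewrite dc in dq wdq qE.
  have sqp : size q = size p.
    by apply/eqP; rewrite eqn_leq (stop q p c) // (stop p q c).
  rewrite (mpath_labels (het_le1 het) pP) (mpath_labels (het_le1 het) qP).
  congr map; apply: (@eq_from_nth _ i); rewrite !size_map // => k kq.
  have := qE k.+1 kq; rewrite -pE -?sqp //.
- have [t tv] := surj v; rewrite -tv inE negb_or => /andP [vA1 vA2].
  have ct : c <= t.
    rewrite leNgt; apply/negP => tc; case/negP: vA1; rewrite w'E.
    apply: (recurrent_fwd hetT (t := 1 - c)); [lia | lia |].
    by rewrite -/(w' (1 - c)) -w'E wc.
  have tcp : t <= c + (size p)%:Z.
    rewrite leNgt; apply/negP => tc; case/negP: vA2.
    by apply: (recurrent_fwd het cp) => //; [lia | rewrite wcp].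
  have -> : w t = nth i (mpath_vertices i p) (absz (t - c)).
    by rewrite pE; [congr w|]; lia.
  by apply: mem_nth; rewrite /= size_map; lia.
Qed.

(** * Two cycles joined by a path carry a heteroclinic orbit *)

Definition reach n (M : 'M[nat]_n) u w : Prop := exists k : nat, (M ^+ k) u w != 0%N.

Section Reach.
Variables (n : nat) (M : 'M[nat]_n).

Lemma reach_refl u : reach M u u.
Proof. by exists 0%N; rewrite expr0 mxE eqxx. Qed.

Lemma reach_edge u w : M u w != 0%N -> reach M u w.
Proof. by exists 1%N; rewrite expr1. Qed.

Lemma reach_trans u v w : reach M u v -> reach M v w -> reach M u w.
Proof. by move=> [k uv] [l vw]; exists (k + l)%N; rewrite exprD; exact: mul_neq0 uv vw. Qed.

Lemma reach_path u w : reach M u w ->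
  exists2 q, path (fun a b => M a b != 0%N) u q & last u q = w.
Proof.
move=> [k]; elim: k u => [|k IH] u.
  by rewrite expr0 mxE; have [<- _|] := eqVneq u w; [exists [::] | rewrite eqxx].
rewrite exprS => /sum_mul_neq0 [t ut /IH [q tq qw]].
by exists (t :: q) => //=; rewrite ut.
Qed.

Lemma path_reach u q : path (fun a b => M a b != 0%N) u q ->
  forall v, v \in u :: q -> reach M u v /\ reach M v (last u q).
Proof.
elim: q u => [|t q IH] u /=.
  by move=> _ v; rewrite inE => /eqP ->; split; exact: reach_refl.
case/andP => ut tq v; rewrite inE => /orP [/eqP ->|vq].
  split; first exact: reach_refl.
  by apply: reach_trans (reach_edge ut) _; have [] := IH t tq t (mem_head _ _).
have [tv vl] := IH t tq v vq; split=> //.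
exact: reach_trans (reach_edge ut) tv.
Qed.

(** A walk between two vertices of the class of [u] stays in the class; the edge
    to [t] provides walks of positive length. *)
Lemma class_irreducible u t : M u t != 0%N -> reach M t u ->
  irreducible_submx M [set v | `[< reach M u v /\ reach M v u >]]%SET.
Proof.
move=> ut tu; apply/irreducible_submxP; split.
  by apply/set0Pn; exists u; rewrite inE; apply/asboolP; split; exact: reach_refl.
move=> x y xC yC.
have [ux xu] : reach M u x /\ reach M x u by move: xC; rewrite inE => /asboolP.
have [uy yu] : reach M u y /\ reach M y u by move: yC; rewrite inE => /asboolP.
have [k [k0 xy]] : exists k : nat, (0 < k)%N /\ (M ^+ k) x y != 0%N.
  have [k xk] := xu; have [l ul] := reach_trans tu uy.
  exists (k + l.+1)%N; split; first lia.
  by rewrite exprD exprS; apply: mul_neq0 xk (mul_neq0 ut ul).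
move/pow_walkP: xy => [a [a0 ak walk]]; exists k, a; split=> // i ik.
rewrite inE; apply/asboolP.
have xa : reach M x (a i).
  exists i; apply/pow_walkP; exists a; split=> // j ji; apply: walk.
  exact: leq_trans ji ik.
have ay : reach M (a i) y.
  exists (k - i)%N; apply/pow_walkP; exists (fun j => a (i + j)%N); split.
  - by rewrite addn0.
  - by rewrite subnKC.
  - by move=> j jk; rewrite addnS; apply: walk; lia.
by split; [exact: reach_trans ux xa | exact: reach_trans ay yu].
Qed.

Lemma irreducible_submx_reach S u v : irreducible_submx M S -> u \in S -> v \in S ->
  reach M u v.
Proof.
move=> /irreducible_submxP [_ irr] uS vS.
have [k [a [_ a0 ak _ walk]]] := irr u v uS vS.
by exists k; apply/pow_walkP; exists a.
Qed.

Lemma irreducible_submx_step S u : irreducible_submx M S -> u \in S ->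
  exists2 v, v \in S & M u v != 0%N.
Proof.
move=> /irreducible_submxP [_ irr] uS.
have [k [a [k0 a0 ak aS walk]]] := irr u u uS uS.
by exists (a 1%N); [exact: aS | rewrite -a0; exact: walk].
Qed.

Lemma perm_submxP S : is_perm_mx (principal_submx M S) ->
  [/\ forall u v, u \in S -> v \in S -> (M u v <= 1)%N,
      forall u v v', u \in S -> v \in S -> v' \in S ->
        M u v != 0%N -> M u v' != 0%N -> v = v'
    & forall u u' v, u \in S -> u' \in S -> v \in S ->
        M u v != 0%N -> M u' v != 0%N -> u = u'].
Proof.
case/is_perm_mxP => f fE.
have E u v (uS : u \in S) (vS : v \in S) :
    M u v = (f (enum_rank_in uS u) == enum_rank_in vS v) :> nat.
  move/matrixP: fE => /(_ (enum_rank_in uS u) (enum_rank_in vS v)).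
  by rewrite !mxE !enum_rankK_in // => ->; case: (_ == _).
have Ef u v (uS : u \in S) (vS : v \in S) : M u v != 0%N ->
    f (enum_rank_in uS u) = enum_rank_in vS v.
  by rewrite (E u v uS vS); case: (f _ =P _).
have rank_inj u v (uS : u \in S) (vS : v \in S) :
    enum_rank_in uS u = enum_rank_in vS v -> u = v.
  by move=> /(congr1 enum_val); rewrite !enum_rankK_in.
split=> [u v uS vS|u v v' uS vS v'S|u u' v uS u'S vS].
- by rewrite (E u v uS vS); case: eqP.
- move=> /(Ef _ _ uS vS) e /(Ef _ _ uS v'S); rewrite e; exact: rank_inj.
- move=> /(Ef _ _ uS vS) e /(Ef _ _ u'S vS); rewrite -e => /perm_inj e'.
  exact: (rank_inj _ _ _ _ (esym e')).
Qed.

(** The only edge of [T] leaving a vertex of [S] must be the one that [S] needs to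
    be irreducible, so walks of [T] cannot leave [S]. *)
Lemma irreducible_sub_perm S T : irreducible_submx M S -> irreducible_submx M T ->
  is_perm_mx (principal_submx M T) -> S \subset T -> S = T.
Proof.
move=> Sirr Tirr /perm_submxP [_ out _] sST; apply/eqP; rewrite finset.eqEsubset sST /=.
apply/fintype.subsetP => v vT; have [/set0Pn [u uS] _] := Sirr.
have uT := fintype.subsetP sST _ uS.
have /irreducible_submxP [_ irr] := Tirr.
have [k [a [_ a0 <- aT walk]]] := irr u v uT vT.
elim: k aT walk => [_ _|k IH aT walk]; first by rewrite a0.
have akS : a k \in S.
  by apply: IH => i ik; [apply: aT | apply: walk]; exact: ltnW.
have [t tS akt] := irreducible_submx_step Sirr akS.
have -> : a k.+1 = t; last exact: tS.
by apply: (out (a k)) => //; [apply: aT | apply: aT | exact: (fintype.subsetP sST) | exact: walk].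
Qed.
End Reach.

Lemma path_closed n (M : 'M[nat]_n) (S : 'I_n -> Prop) u q :
  (forall a b, S a -> M a b != 0%N -> S b) ->
  path (fun a b => M a b != 0%N) u q -> S u -> forall v, v \in u :: q -> S v.
Proof.
move=> Sc; elim: q u => [|t q IH] u /=; first by move=> _ Su v; rewrite inE => /eqP ->.
case/andP => ut tq Su v; rewrite inE => /orP [/eqP ->//|]; apply: IH => //.
exact: Sc Su ut.
Qed.

Lemma reach_closed n (M : 'M[nat]_n) (S : 'I_n -> Prop) u v :
  (forall a b, S a -> M a b != 0%N -> S b) -> reach M u v -> S u -> S v.
Proof.
move=> Sc /reach_path [q uq <-] Su; apply: (path_closed Sc uq Su).
exact: mem_last.
Qed.

Lemma mpath_path n (M : 'M[nat]_n) i j p : is_mpath M i j p ->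
  path (fun a b => M a b != 0%N) i [seq w.1 | w <- p].
Proof.
case/and3P => pp _ _; rewrite -[i]/((i, 0%N).1).
elim: p (i, 0%N) pp => //= w p IH u /andP [lt /IH ->].
by rewrite andbT -lt0n; exact: (leq_ltn_trans (leq0n _) lt).
Qed.

(** A path from [i] to [u] outside the closed set [S] and a path from [v] to [j]
    inside [S] have no vertex in common. *)
Lemma mpath_through n (M : 'M[nat]_n) (S : {set 'I_n}) i j u v (e : nat) :
  (forall a b, a \in S -> M a b != 0%N -> b \in S) ->
  u \notin S -> v \in S -> (e < M u v)%N -> reach M i u -> reach M v j ->
  exists p1 p2, [/\ is_mpath M i j (p1 ++ (v, e) :: p2),
    last i [seq w.1 | w <- p1] = u & all [pred w : 'I_n * nat | w.1 \notin S] p1].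
Proof.
move=> Sc uS vS euv iu vj.
have simple x y : reach M x y -> exists p, is_mpath M x y p.
  by move=> /reach_path [q xq <-]; exact: path_mpath.
have [p1 p1M] := simple i u iu; have [p2 p2M] := simple v j vj.
have /and3P [p1P p1u /eqP p1l] := p1M; have /and3P [p2P p2u /eqP p2l] := p2M.
have out x : x \in i :: [seq w.1 | w <- p1] -> x \notin S.
  move=> xp; apply: contra uS => xS.
  have [_ xu] := path_reach (mpath_path p1M) xp; rewrite p1l in xu.
  exact: (@reach_closed n M (fun a => a \in S) x u Sc xu xS).
have inn x : x \in v :: [seq w.1 | w <- p2] -> x \in S.
  exact: (@path_closed n M (fun a => a \in S) v _ Sc (mpath_path p2M) vS).
exists p1, p2; split=> //; last first.
  apply/allP => -[x l] xp /=; apply: out.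
  by rewrite inE; apply/orP; right; apply: (map_f fst xp).
have last1 : (last (i, 0%N) p1).1 = u by rewrite -p1l -(last_map fst).
have tailP : path (fun a b : 'I_n * nat => (b.2 < M a.1 b.1)%N) (v, e) p2.
  by case: (p2) p2P.
apply/and3P; split.
- by rewrite cat_path p1P /= last1 euv.
- rewrite /mpath_vertices map_cat -cat_cons cat_uniq p1u [map _ (_ :: _)]/= p2u andbT.
  by apply/hasPn => x /inn xS; apply/negP => /out; rewrite xS.
- by rewrite map_cat last_cat /= p2l.
Qed.

(** The walk [w] is forced to follow the unique edges inside [S] in the future and
    the unique edges outside [S] in the past, hence it exhausts what is
    reachable from [w 1] and what reaches [w 0]. *)
Lemma cut_heteroclinic n (M : 'M[nat]_n) (S : {set 'I_n}) (w : int -> 'I_n) :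
  (forall u v, u \in S -> M u v != 0%N -> v \in S) ->
  (forall u v, (M u v <= 1)%N) ->
  (forall u v v', u \in S -> M u v != 0%N -> M u v' != 0%N -> v = v') ->
  (forall u u' v, v \notin S -> M u v != 0%N -> M u' v != 0%N -> u = u') ->
  (forall u v, u \notin S -> v \in S -> M u v != 0%N -> u = w 0 /\ v = w 1) ->
  (forall t, M (w t) (w (t + 1)) != 0%N) -> w 0 \notin S -> w 1 \in S ->
  (forall v, v \in S -> reach M (w 1) v) -> (forall v, reach M v (w 1)) ->
  heteroclinic M w.
Proof.
move=> Sc le1 out1 in1 cross walk w0S w1S from1 to1.
have w_mono (t t' : int) : t <= t' -> w t \in S -> w t' \in S.
  move=> tt' wt; have -> : t' = t + (absz (t' - t))%:Z by lia.
  elim: (absz _) => [|k IH]; first by rewrite addr0.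
  have -> : t + k.+1%:Z = t + k%:Z + 1 by lia.
  exact: (Sc _ _ IH (walk _)).
have w_out t : t <= 0 -> w t \notin S by move=> t0; apply: contra w0S; exact: w_mono.
have w_in t : 0 < t -> w t \in S by move=> t0; apply: (@w_mono 1).
have pos t : w t \in S -> 0 < t.
  by move=> tS; rewrite ltNge; apply/negP => /w_out; rewrite tS.
have neg t : w t \notin S -> t <= 0 by rewrite leNgt; apply: contra => /w_in.
have fwd t v : 0 < t -> M (w t) v != 0%N -> v = w (t + 1).
  by move=> t0 tv; apply: (out1 (w t)) => //; exact: w_in.
have bwd t u : t <= 0 -> M u (w t) != 0%N -> u = w (t - 1).
  move=> t0 ut; apply: (in1 _ _ (w t)) => //; first exact: w_out.
  by have := walk (t - 1); rewrite subrK.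
have surjS v : v \in S -> exists t, w t = v.
  move=> vS; suff [t [_ <-]] : exists t, 0 < t /\ w t = v by exists t.
  apply: (@reach_closed n M (fun a => exists t, 0 < t /\ w t = a) (w 1) v).
  - by move=> a b [t [t0 <-]] /(fwd _ _ t0) ->; exists (t + 1); split=> //; lia.
  - exact: from1.
  - by exists 1.
have surj v : exists t, w t = v.
  (* the vertices off the orbit form a set closed under successors *)
  apply: contrapT => nv.
  suff : ~ exists t, w t = w 1 by apply; exists 1.
  apply: (@reach_closed n M (fun a => ~ exists t, w t = a) v) => //.
  move=> a b na ab [t tb]; apply: na.
  have [aS|aS] := boolP (a \in S); first exact: surjS.
  have [bS|bS] := boolP (b \in S).
    by have [-> _] := cross a b aS bS ab; exists 0.
  by exists (t - 1); symmetry; apply: bwd; rewrite ?neg ?tb.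
have edges u v : M u v != 0%N -> exists t, u = w t /\ v = w (t + 1).
  move=> uv; have [tu E] := surj u; have [tv E'] := surj v.
  have [uS|uS] := boolP (u \in S).
    by exists tu; split=> //; apply: fwd; rewrite ?pos ?E.
  have [vS|vS] := boolP (v \in S).
    by have [-> ->] := cross u v uS vS uv; exists 0; rewrite add0r.
  by exists (tv - 1); rewrite subrK; split=> //; apply: bwd; rewrite ?neg ?E'.
split=> //.
- by move=> t t' t0 t'0 E; have := w_out t t0; rewrite E w_in.
- by move=> t; apply/eqP; rewrite eqn_leq lt0n walk le1.
- split=> t t' t0 t'0 E.
  + by apply: fwd => //; rewrite -E; exact: walk.
  + by apply: bwd => //; rewrite -E; have := walk (t - 1); rewrite subrK.
Qed.

(** Every cycle lies in [A1] or in [A2], and all vertices lie between these two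
    classes.  If a closed set [S] contains [A2] but not [A1], only one edge can
    enter it, since every edge entering [S] extends to a path from [A1] to [A2]
    and that path is unique ([crossing]).  Taking [S = A2] gives the edge from
    [w 0] to [w 1]; taking for [S] the set of vertices reached from [v] shows
    that a vertex [v] between the two cycles has a single incoming edge. *)
Lemma joined_heteroclinic n (M : 'M[nat]_n) :
  (forall u v, M u v != 0%N -> exists w : int -> 'I_n,
    [/\ forall t, M (w t) (w (t + 1)) != 0%N, w 0 = u & w 1 = v]) ->
  two_cycles_joined M -> exists w, heteroclinic M w.
Proof.
move=> orbit_through [A1 [A2 [A12 [irr1 perm1] [irr2 perm2] only joined]]].
have classP u t : M u t != 0%N -> reach M t u ->
    let C := [set v | `[< reach M u v /\ reach M v u >]]%SET in C = A1 \/ C = A2 by move=> ut tu; apply: only; exact: class_irreducible ut tu.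
have disj u : u \in A1 -> u \in A2 -> False.
  move=> u1 u2; have [t tA ut] := irreducible_submx_step irr1 u1.
  have sub1 : A1 \subset [set v | `[< reach M u v /\ reach M v u >]]%SET.
    apply/fintype.subsetP => v vA; rewrite inE; apply/asboolP.
    by split; exact: irreducible_submx_reach irr1 _ _.
  have sub2 : A2 \subset [set v | `[< reach M u v /\ reach M v u >]]%SET.
    apply/fintype.subsetP => v vA; rewrite inE; apply/asboolP.
    by split; exact: irreducible_submx_reach irr2 _ _.
  have [E|E] := classP u t ut (irreducible_submx_reach irr1 tA u1).
    by apply: A12; rewrite E in sub2; rewrite (irreducible_sub_perm irr2 irr1 perm1 sub2).
  by apply: A12; rewrite E in sub1; exact: (irreducible_sub_perm irr1 irr2 perm2 sub1).
have class1 u v : u \in A1 -> reach M u v -> reach M v u -> v \in A1.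
  move=> u1 uv vu; have [t tA ut] := irreducible_submx_step irr1 u1.
  have [E|E] := classP u t ut (irreducible_submx_reach irr1 tA u1).
    by rewrite -E inE; apply/asboolP.
  by case: (disj u) => //; rewrite -E inE; apply/asboolP; split; exact: reach_refl.
have class2 u v : u \in A2 -> reach M u v -> reach M v u -> v \in A2.
  move=> u2 uv vu; have [t tA ut] := irreducible_submx_step irr2 u2.
  have [E|E] := classP u t ut (irreducible_submx_reach irr2 tA u2).
    by case: (disj u) => //; rewrite -E inE; apply/asboolP; split; exact: reach_refl.
  by rewrite -E inE; apply/asboolP.
have cycleA u t : M u t != 0%N -> reach M t u -> u \in A1 :|: A2.
  move=> ut tu; have uu : u \in [set v | `[< reach M u v /\ reach M v u >]]%SET.
    by rewrite inE; apply/asboolP; split; exact: reach_refl.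
  by rewrite finset.in_setU; have [E|E] := classP u t ut tu; rewrite E in uu; rewrite uu ?orbT.
have [/set0Pn [i i1] _] := irr1; have [/set0Pn [j j2] _] := irr2.
have on_path x y v : x \in A1 -> y \in A2 -> v \notin A1 :|: A2 -> reach M x v /\ reach M v y.
  move=> x1 y2 vA; have [p [pP _ /(_ v vA) vp]] := joined x y x1 y2.
  have := path_reach (mpath_path pP) vp; by case/and3P: pP => _ _ /eqP ->.
have A1A2 x y : x \in A1 -> y \in A2 -> reach M x y.
  move=> x1 y2; have [p [pP _ _]] := joined x y x1 y2.
  have [_] := path_reach (mpath_path pP) (mem_head _ _).
  by case/and3P: pP => _ _ /eqP ->.
have toA2 v y : y \in A2 -> reach M v y.
  move=> y2; have [v1|v1] := boolP (v \in A1); first exact: A1A2.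
  have [v2|v2] := boolP (v \in A2); first exact: irreducible_submx_reach irr2 _ _.
  by have [] := on_path i y v i1 y2; rewrite // finset.in_setU negb_or v1.
have fromA1 x v : x \in A1 -> reach M x v.
  move=> x1; have [v1|v1] := boolP (v \in A1); first exact: irreducible_submx_reach irr1 _ _.
  have [v2|v2] := boolP (v \in A2); first exact: A1A2.
  by have [] := on_path x j v x1 j2; rewrite // finset.in_setU negb_or v1.
have closed2 u v : u \in A2 -> M u v != 0%N -> v \in A2.
  by move=> u2 uv; apply: class2 u2 (reach_edge uv) (toA2 _ _ u2).
have closed1 u v : v \in A1 -> M u v != 0%N -> u \in A1.
  by move=> v1 uv; apply: class1 v1 (fromA1 _ _ v1) (reach_edge uv).
(* The two edges are found on the unique path as the place where it enters [S]. *)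
have crossing (S : {set 'I_n}) u v e u' v' e' :
    (forall a b, a \in S -> M a b != 0%N -> b \in S) ->
    u \notin S -> v \in S -> (e < M u v)%N ->
    u' \notin S -> v' \in S -> (e' < M u' v')%N -> [/\ u = u', v = v' & e = e'].
  move=> Sc uS vS euv uS' vS' euv'.
  have [p1 [p2 [pP p1l p1S]]] := mpath_through Sc uS vS euv (fromA1 i u i1) (toA2 v j j2).
  have [q1 [q2 [qP q1l q1S]]] := mpath_through Sc uS' vS' euv' (fromA1 i u' i1) (toA2 v' j j2).
  have [p [_ uniq _]] := joined i j i1 j2.
  have E : p1 ++ (v, e) :: p2 = q1 ++ (v', e') :: q2 by rewrite (uniq _ pP) (uniq _ qP).
  have find1 (r1 r2 : seq ('I_n * nat)) z l : z \in S ->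
      all [pred w : 'I_n * nat | w.1 \notin S] r1 ->
      find [pred w : 'I_n * nat | w.1 \in S] (r1 ++ (z, l) :: r2) = size r1.
    move=> zS rS; rewrite find_cat /= zS addn0; case: ifP => // /hasP [w wr /= wS].
    by have /= := allP rS w wr; rewrite wS.
  have sz : size p1 = size q1 by rewrite -(find1 p1 p2 v e) // E find1.
  move/eqP: E; rewrite eqseq_cat // => /andP [/eqP E1 /eqP [-> -> _]].
  by rewrite -p1l -q1l E1.
have le1 m : (forall e e', e < m -> e' < m -> e = e')%N -> (m <= 1)%N.
  by move=> uniq; rewrite leqNgt; apply/negP => m1; have := uniq 0%N 1%N (ltnW m1) m1.
have cross2 u v u' v' : u \notin A2 -> v \in A2 -> M u v != 0%N ->
    u' \notin A2 -> v' \in A2 -> M u' v' != 0%N -> [/\ u = u', v = v' & (M u v <= 1)%N].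
  rewrite -!lt0n => uS vS uv uS' vS' uv'.
  have [-> -> _] := crossing A2 u v 0%N u' v' 0%N closed2 uS vS uv uS' vS' uv'.
  split=> //; apply: le1 => e e' eM e'M.
  by have [] := crossing A2 u' v' e u' v' e' closed2 uS' vS' eM uS' vS' e'M.
have [in1 in1'] : (forall u u' v, v \notin A2 -> M u v != 0%N -> M u' v != 0%N -> u = u') /\
    (forall u v, v \notin A2 -> (M u v <= 1)%N).
  have [m1 _ in1] := perm_submxP perm1.
  pose S v : {set 'I_n} := [set x | `[< reach M v x >]]%SET.
  have SP v x : x \in S v <-> reach M v x by rewrite inE; split=> /asboolP.
  have Sc v a b : a \in S v -> M a b != 0%N -> b \in S v.
    by move=> /SP va ab; apply/SP; exact: (reach_trans va (reach_edge ab)).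
  have vS v : v \in S v by apply/SP; exact: reach_refl.
  have uS u v : v \notin A1 -> v \notin A2 -> M u v != 0%N -> u \notin S v.
    move=> v1 v2 uv; apply/negP => /SP vu.
    have := cycleA u v uv vu; rewrite finset.in_setU => /orP [u1|u2].
      by case/negP: v1; apply: (class1 u v u1 (reach_edge uv) vu).
    by case/negP: v2; apply: (closed2 u v u2 uv).
  split=> [u u' v v2 uv u'v|u v v2].
    have [v1|v1] := boolP (v \in A1).
      by apply: (in1 u u' v) => //; [exact: closed1 uv | exact: closed1 u'v].
    have [] // := crossing (S v) u v 0%N u' v 0%N (Sc v); rewrite ?lt0n //; exact: uS.
  have [->//|uv] := eqVneq (M u v) 0%N.
  have [v1|v1] := boolP (v \in A1); first by apply: m1 => //; exact: closed1 uv.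
  apply: le1 => e e' eM e'M.
  by have [] // := crossing (S v) u v e u v e' (Sc v); rewrite ?uS.
have [m2 out2 _] := perm_submxP perm2.
have i2 : i \notin A2 by apply/negP => i2; exact: disj i1 i2.
have [u0 [v0 [u02 v02 uv0]]] : exists u v, [/\ u \notin A2, v \in A2 & M u v != 0%N].
  apply: contrapT => no.
  have : j \notin A2; last by rewrite j2.
  apply: (@reach_closed n M (fun a => a \notin A2) i j) => //; last exact: fromA1.
  by move=> a b a2 ab; apply/negP => b2; apply: no; exists a, b.
have [w [walk w0 w1]] := orbit_through _ _ uv0.
exists w; apply: (@cut_heteroclinic n M A2) => //; rewrite ?w0 ?w1 //.
- move=> u v; have [->//|uv] := eqVneq (M u v) 0%N.
  have [v2|v2] := boolP (v \in A2); last exact: in1'.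
  have [u2|u2] := boolP (u \in A2); first exact: m2.
  by have [_ _] := cross2 _ _ _ _ u2 v2 uv u02 v02 uv0.
- move=> u v v' u2 uv uv'.
  by apply: (out2 u) => //; [exact: (closed2 _ _ u2 uv) | exact: (closed2 _ _ u2 uv')].
- by move=> u v u2 v2 uv; have [-> -> _] := cross2 _ _ _ _ u2 v2 uv u02 v02 uv0.
- by move=> v; exact: toA2.
- by move=> v; exact: toA2.
Qed.

(** * The equivalence *)

Lemma box_transitive_iff n (h v : rel 'I_n) (r s : nat) :
  commuting h v -> (forall a, exists2 x, admissible h v x & x (0, 0) = a) ->
  (0 < r)%N -> (0 < s)%N ->
  box_transitive r%:Z s%:Z (admissible h v) <->
    irreducible_mx (adjmx h ^+ r *m adjmx v ^+ s) \/
    two_cycles_joined (adjmx h ^+ r *m adjmx v ^+ s).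
Proof.
move=> hv occurs r0 s0; have MP := represents_M hv occurs r s; split=> [tr|[irr|joined]].
- have [irr|nirr] := pselect (irreducible_mx (adjmx h ^+ r *m adjmx v ^+ s)); first by left.
  have [w het] := transitive_heteroclinic hv occurs MP r0 s0 tr nirr.
  by right; exact: heteroclinic_joined het.
- exact: (irreducible_box_transitive hv occurs MP r0 s0 irr).
- have [|w het] := joined_heteroclinic _ joined.
    move=> u t /(realize_edge_diag hv occurs MP) [x [xP x0 x1]].
    by exists (diag r s x); split=> // k; exact: (diag_edge hv occurs MP).
  exact: heteroclinic_box_transitive het.
Qed.

Lemma admissible_reflect (A : Type) (h v : rel A) x : admissible h v x ->
  admissible (fun a b => h b a) (fun a b => v b a) (fun t => x (- t)).
Proof.
move=> xP p q; have oppE (a b : int) : - (a, b) = (- a, - b) by [].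
have [hx _] := xP (- (p + 1)) (- q); have [_ vx] := xP (- p) (- (q + 1)).
rewrite /= !oppE; split; [apply: (rel_at h x hx) | apply: (rel_at v x vx)]; split; lia.
Qed.

(** The symmetry [a |-> - a] of the plane reverses all edges; it reduces negative
    exponents to positive ones. *)
Lemma box_transitive_reflect n (h v : rel 'I_n) (r s : int) :
  box_transitive r s (admissible h v) ->
  box_transitive (- r) (- s) (admissible (fun a b => h b a) (fun a b => v b a)).
Proof.
have oppE (a b : int) : - (a, b) = (- a, - b) by [].
move=> tr j x y xP yP.
have [k [z [zP zx zy]]] := tr j _ _ (admissible_reflect xP) (admissible_reflect yP).
exists k, (fun t => z (- t)); split; first exact: admissible_reflect zP.
- move=> p q pj qj; rewrite oppE zx ?oppE; [|lia|lia].
  by rewrite !opprK.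
- move=> p q pj qj.
  have -> : - ((p, q) + (k * - r, k * - s)) = (- p, - q) + (k * r, k * s).
    by congr (_, _) => /=; lia.
  by rewrite (zy (- p) (- q)) ?oppE ?opprK //; lia.
Qed.

Lemma adjmx_tr n (e : rel 'I_n) : (adjmx e)^T = adjmx (fun a b => e b a).
Proof. by apply/matrixP => i j; rewrite !mxE. Qed.

Lemma X_admissible n (G : graph2 n) : X_ G = admissible (hgraph G) (vgraph G).
Proof.
apply/seteqP; split=> x xP p q; have := xP p q; rewrite !mxE.
  by case: (hgraph G _ _) => -[] //; case: (vgraph G _ _).
by move=> [-> ->].
Qed.

Theorem corollary3 (n : nat) (G : graph2 n)
    (X_nonempty : X_ G !=set0)
    (G_reduced : all_vertices_occur G)
    (HV_VH : forall i j : 'I_n,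
       (hmx G *m vmx G) i j <> 0 <-> (vmx G *m hmx G) i j <> 0)
    (r s : int) (rs_gt0 : 0 < r * s) :
  transitive2 r s (X_ G) <->
    irreducible_mx (dirmx G r s) \/ two_cycles_joined (dirmx G r s).
Proof.
pose h := hgraph G; pose v := vgraph G.
have adj_neq0 (e : rel 'I_n) a b : adjmx e a b != 0%N <-> e a b.
  by rewrite mxE; case: (e a b).
have prodP (e f : rel 'I_n) a c :
    (adjmx e *m adjmx f) a c <> 0 <-> exists b, e a b /\ f b c.
  split=> [/eqP /sum_mul_neq0 [b /adj_neq0 ab /adj_neq0 bc]|[b [ab bc]]]; first by exists b.
  by apply/eqP; apply: (@mul_neq0 _ _ _ _ b); apply/adj_neq0.
have hv : commuting h v.
  by move=> a c; split=> [/prodP /HV_VH /prodP|/prodP /HV_VH /prodP].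
have occurs a : exists2 x, admissible h v x & x (0, 0) = a.
  have [x [k [xP xk]]] := G_reduced a; rewrite X_admissible in xP.
  by exists (fun t => x (t + k)); [exact: admissible_shift | rewrite add0r].
have shiftX a x : X_ G x -> X_ G (shift a x).
  by rewrite X_admissible; exact: admissible_shift.
apply: (iff_trans (transitive2_box r s shiftX)); rewrite X_admissible.
have [[r_gt0 s_gt0]|[r_lt0 s_lt0]] : 0 < r /\ 0 < s \/ r < 0 /\ s < 0.
  have [r0|r0|r0] := ltrgtP r 0.
  - by right; rewrite -(nmulr_rgt0 _ r0).
  - by left; rewrite -(pmulr_rgt0 _ r0).
  - by rewrite r0 mul0r ltxx in rs_gt0.
- have -> : dirmx G r s = adjmx h ^+ absz r *m adjmx v ^+ absz s.
    by rewrite /dirmx /mxpowz !ltW.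
  have := @box_transitive_iff n h v (absz r) (absz s) hv occurs.
  by rewrite !gtz0_abs //; apply; lia.
- pose h' a b := h b a; pose v' a b := v b a.
  have -> : dirmx G r s = adjmx h' ^+ absz r *m adjmx v' ^+ absz s.
    by rewrite /dirmx /mxpowz !leNgt r_lt0 s_lt0 /= !adjmx_tr.
  have hv' : commuting h' v'.
    move=> a c; split=> -[b [ab bc]].
      by have [d [cd da]] := (hv c a).2 (ex_intro _ b (conj bc ab)); exists d.
    by have [d [cd da]] := (hv c a).1 (ex_intro _ b (conj bc ab)); exists d.
  have occurs' a : exists2 x, admissible h' v' x & x (0, 0) = a.
    have [x xP xa] := occurs a; exists (fun t => x (- t)).
      exact: admissible_reflect xP.
    by rewrite oppr0.
  have := @box_transitive_iff n h' v' (absz r) (absz s) hv' occurs'.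
  rewrite !ltz0_abs // => core; apply: (iff_trans _ (core _ _)); [|lia|lia].
  split=> [|tr]; first exact: box_transitive_reflect.
  by have := box_transitive_reflect tr; rewrite !opprK.
Qed.
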